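(* Let $r\ge 3$ and $k\ge 2r+13$ be integers, and put $m=\lfloor (k-1)/2\rfloor$. There exists $N_{k,r}$ such that for every integer $n>N_{k,r}$ the following holds. Every connected $n$-vertex $r$-graph containing no Berge-path of length $k$ has at most $$\binom{m}{r-1}(n-m)+\binom{m}{r}+\mathbb{1}_{2\mid k}\binom{m}{r-2}$$ hyperedges. Moreover $\mathcal H_{n,k}$ is such an $r$-graph with exactly this many hyperedges, and every connected $n$-vertex $r$-graph with no Berge-path of length $k$ attaining this number of hyperedges is isomorphic to $\mathcal H_{n,k}$.
   Context: An $r$-graph is a simple $r$-uniform hypergraph. A Berge-path of length $t$ in a hypergraph is an alternating sequence $v_1,e_1,v_2,e_2,\dots,e_t,v_{t+1}$ of $t+1$ distinct vertices and $t$ distinct hyperedges with $\{v_i,v_{i+1}\}\subseteq e_i$ for $i=1,\dots,t$. $\mathbb{1}_{2\mid k}$ equals $1$ if $k$ is even and $0$ otherwise. The $r$-graph $\mathcal H_{n,k}$ is defined as follows. If $k$ is odd, partition an $n$-element vertex set into $A$ and $B$ with $|A|=(k-1)/2$; the hyperedges are all $r$-subsets containing at most one vertex of $B$. If $k$ is even, partition an $n$-element vertex set into $A$ and $B$ with $|A|=(k-2)/2$ and fix two distinct vertices $b_1,b_2\in B$; the hyperedges are all $r$-subsets containing at most one vertex of $B$, together with all $r$-subsets consisting of $b_1$, $b_2$ and $r-2$ vertices of $A$. *)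

(* Defs.v *)
From mathcomp Require Import all_boot all_fingroup.
Set Implicit Arguments. Unset Strict Implicit. Unset Printing Implicit Defensive.

Definition uniform (n r : nat) (H : {set {set 'I_n}}) : Prop :=
  forall e, e \in H -> #|e| = r.

Definition hadj (n : nat) (H : {set {set 'I_n}}) : rel 'I_n :=
  fun x y => [exists e in H, (x \in e) && (y \in e)].

Definition hconnected (n : nat) (H : {set {set 'I_n}}) : Prop :=
  forall x y : 'I_n, connect (hadj H) x y.

Definition has_berge_path (n : nat) (H : {set {set 'I_n}}) (t : nat) : Prop :=
  exists (v : 'I_t.+1 -> 'I_n) (e : 'I_t -> {set 'I_n}),
    injective v /\ injective e /\
    forall i : 'I_t, [/\ e i \in H,
                         v (widen_ord (leqnSn t) i) \in e i &
                         v (lift ord0 i) \in e i].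

Definition Hsize_A (k : nat) : nat := if odd k then (k - 1) %/ 2 else (k - 2) %/ 2.

Definition Hset_A (n k : nat) : {set 'I_n} := [set v : 'I_n | val v < Hsize_A k].

Definition Hnk (n k r : nat) : {set {set 'I_n}} :=
  [set e : {set 'I_n} | (#|e| == r) &&
     ((#|e :\: Hset_A n k| <= 1) ||
      (~~ odd k &&
        (e :\: Hset_A n k ==
           [set v : 'I_n | (val v == Hsize_A k) || (val v == (Hsize_A k).+1)])))].

Definition isomorphic (n : nat) (H1 H2 : {set {set 'I_n}}) : Prop :=
  exists f : {perm 'I_n}, [set ((f : 'I_n -> 'I_n) @: e) | e : {set 'I_n} in H1] = H2.

Definition extremal_bound (n k r : nat) : nat :=
  let m := (k - 1) %/ 2 in
  'C(m, r - 1) * (n - m) + 'C(m, r) + (~~ odd k) * 'C(m, r - 2).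

(* Main.v *)
Require Import Defs.
From mathcomp Require Import all_boot all_fingroup.
From mathcomp Require Import zify.
From Stdlib Require Classical_Prop.
Set Implicit Arguments. Unset Strict Implicit. Unset Printing Implicit Defensive.

(** Write [D = 'C(m, r - 1)], so that [k] is [2m + 1] or [2m + 2] and the bound is
    [D * n - c] for a positive constant [c].

    Two applications of Hall's theorem replace the hypergraph by a graph in which every edge
    owns a hyperedge containing it, together with an antichain, in bijection with the
    hyperedges, of "red" graph edges and "blue" [r]-cliques.  Graph paths lift to Berge
    paths, so the graph has no path of length [k], and a vertex with at most [m] neighbours
    lies in at most [D] members of the antichain.

    A large connected graph without a path of length [k] has a vertex set [S] such that many
    components of the rest are each attached to every vertex of [S].  After discarding sets of
    one or two vertices which lie in fewer than [D] members per vertex, comparing two longest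
    paths leaving [S] into different components forces [#|S| = m], and almost all of these
    components to be single vertices completely joined to [S].  Zigzagging through [S] then
    leaves at most one edge outside [S], and only for even [k].  The discarded vertices
    strictly increase the surplus over the bound, so there are none.

    The graph itself may be disconnected.  A component with at least [D] members per vertex
    starts paths of length [m + 1], one with at least [D - 1] paths of length [m]; a shortest
    chain of hyperedges between two such components would yield a Berge path of length [k].
    Since the total surplus is bounded below, the graph is connected when [n] is large. *)

(** Paths in the graph of all pairs covered by hyperedges need not lift to Berge paths, because one
    hyperedge covers many pairs. So a hyperedge keeps all its pairs only inside a family in which
    every covered pair can be given a private hyperedge, and otherwise it keeps a single pair. The
    price is that connectedness of the hypergraph may not survive in the graph; it returns only
    through the chains of hyperedges between components.

    The antichain property makes the local count sharp: the red and the blue neighbours of a vertex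
    are disjoint, so [p] neighbours allow at most [a + 'C(b, r - 1)] members with [a + b <= p]. The
    hypothesis [k >= 2r + 13] says exactly [m >= r + 6], and this margin makes every red neighbour a
    strict loss against [D].

    Sets of two vertices are discarded, and not only single vertices, because the last two vertices
    of a longest path might each lie in [D] members while together they meet fewer than [2D]. *)

(** * Binomial estimates *)

Lemma leq_bin2r_step (d b j : nat) : 'C(b, d.+1) + j * 'C(b, d) <= 'C(b + j, d.+1).
Proof.
elim: j => [|j IH]; first by rewrite mul0n !addn0.
rewrite addnS binS mulSn.
have : 'C(b, d) <= 'C(b + j, d) by apply: leq_bin2l; rewrite leq_addr.
lia.
Qed.

(** From [b >= d.+1] on, Pascal's rule gains at least [d.+1 >= 2] whenever [b] grows by one, so
    exchanging a blue neighbour for a red one is a strict loss. For [b <= d] the binomial vanishes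
    and the climb starts at [d.+1], where the margin [d + 8 <= m] leaves enough steps. *)
Lemma bin_gap (d m b : nat) : 0 < d -> d + 8 <= m -> b < m ->
  'C(b, d.+1) + (m - b) < 'C(m, d.+1).
Proof.
move=> d0 dm bm; case: (leqP d.+1 b) => hb.
  have := leq_bin2r_step d b (m - b); rewrite subnKC ?(ltnW bm) //.
  have : 'C(d.+1, d) <= 'C(b, d) by apply: leq_bin2l.
  by rewrite binSn; nia.
rewrite (bin_small hb) add0n.
have := leq_bin2r_step d d.+1 (m - d.+1); rewrite subnKC; last by lia.
by rewrite binSn binn; nia.
Qed.

(** By the ratios of consecutive binomials, ['C(m, d.+2)] is at most m/3 times and ['C(m, d)] at
    most m/8 times ['C(m, d.+1)]; the 3 comes from [d + 2], the 8 from [m - d]. With [d = r - 2]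
    this makes [deficit] positive. *)
Lemma bin_neighbours_lt (d m : nat) : 0 < d -> d + 8 <= m ->
  'C(m, d.+2) + 'C(m, d) < m * 'C(m, d.+1).
Proof.
move=> d0 dm.
have h1 := mul_bin_left m d.+1.
have h2 := mul_bin_left m d.
have h3 : 0 < 'C(m, d.+1) by rewrite bin_gt0; lia.
have h4 : 3 * 'C(m, d.+2) <= d.+2 * 'C(m, d.+2) by rewrite leq_mul2r; lia.
have h5 : 8 * 'C(m, d) <= (m - d) * 'C(m, d) by rewrite leq_mul2r; lia.
have h6 : (m - d.+1) * 'C(m, d.+1) <= m * 'C(m, d.+1) by rewrite leq_mul2r; lia.
have h7 : d.+1 * 'C(m, d.+1) <= m * 'C(m, d.+1) by rewrite leq_mul2r; lia.
have h8 : 0 < m * 'C(m, d.+1) by rewrite muln_gt0 h3 andbT; lia.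
lia.
Qed.

(** * Families of pairs and [r]-sets, and their members through one vertex *)

Section Traces.
Variable T : finType.
Implicit Types (A Y e : {set T}) (M Q : {set {set T}}).

Definition trace_sets (r : nat) A Y : {set {set T}} :=
  [set e : {set T} | (#|e| == r) && (e :\: A == Y)].

Lemma card_trace_sets r A Y : [disjoint Y & A] -> #|Y| <= r ->
  #|trace_sets r A Y| = 'C(#|A|, r - #|Y|).
Proof.
move=> dYA Yr; rewrite -(cards_draws A (r - #|Y|)).
have YA0 : Y :&: A = set0 by apply/eqP; rewrite setI_eq0.
have YDA : Y :\: A = Y by rewrite -[RHS](setID Y A) YA0 set0U.
rewrite -(@card_in_imset _ _ (fun F => Y :|: F)); last first.
  move=> F1 F2; rewrite !inE => /andP[/subsetP s1 _] /andP[/subsetP s2 _] /setP E.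
  apply/setP => x; have := E x; rewrite !inE.
  have [xY|xY] //= := boolP (x \in Y).
  have xA : x \notin A by rewrite (disjointFr dYA xY).
  by rewrite (contraNF (s1 x) xA) (contraNF (s2 x) xA).
apply: eq_card => e; rewrite !inE; apply/andP/imsetP => [[/eqP er /eqP eY]|].
  exists (e :&: A); last by rewrite -eY setUC setID.
  rewrite inE subsetIr /=; have := cardsID A e; rewrite eY; lia.
case=> F; rewrite inE => /andP[sFA /eqP cF] ->; split.
  rewrite cardsU; suff -> : Y :&: F = set0 by rewrite cards0 cF; lia.
  by apply/eqP; rewrite -subset0 -YA0 setIS.
rewrite setDUl YDA; suff -> : F :\: A = set0 by rewrite setU0.
by apply/eqP; rewrite setD_eq0.
Qed.

Definition mixed (r : nat) M : Prop :=
  (forall e, e \in M -> (#|e| == 2) || (#|e| == r)) /\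
  (forall e f, e \in M -> f \in M -> e \subset f -> e = f).

Lemma mixed_sub r M Q : Q \subset M -> mixed r M -> mixed r Q.
Proof.
move=> /subsetP s [h1 h2]; split; first by move=> e /s /h1.
by move=> e f /s he /s hf; apply: h2.
Qed.

(** Let [a] count the vertices of [A] joined to [v] by a member pair and [b] those covered by member
    [r]-sets. The antichain property makes these vertices distinct, and the [r]-sets number at most
    ['C(b, r.-1)]. The last clause serves the equality case: blue vertices filling [A] leave no room
    for a pair. *)
Lemma link_bound r Q (A : {set T}) v : 2 < r -> mixed r Q -> v \notin A ->
    (forall e, e \in Q -> e :\: A = [set v]) ->
  exists a b, [/\ a + b <= #|A|, #|Q| <= a + 'C(b, r.-1) &
     b = #|A| -> Q \subset trace_sets r A [set v]].
Proof.
move=> r3 [hs hanti] vA hQ.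
pose Qr := [set e in Q | #|e| == r].
pose Bn := \bigcup_(e in Qr) (e :&: A).
pose Rn := [set x in A | [set v; x] \in Q].
have vin e : e \in Q -> v \in e.
  by move=> /hQ /setP/(_ v); rewrite !inE eqxx => /andP[].
have BnA : Bn \subset A by apply/bigcupsP => e _; apply: subsetIr.
have dis : [disjoint Rn & Bn].
  apply/pred0P => x /=; apply/negP => /andP[]; rewrite inE => /andP[xA vxQ].
  case/bigcupP => e; rewrite !inE => /andP[eQ er] /andP[xe _].
  have E : [set v; x] = e.
    by apply: hanti => //; rewrite subUset !sub1set xe vin.
  by move: er; rewrite -E cards2; case: eqP => ? //= /eqP; lia.
exists #|Rn|, #|Bn|; split.
- rewrite -cardsUI; have /eqP -> : Rn :&: Bn == set0 by rewrite setI_eq0.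
  rewrite cards0 addn0; apply: subset_leq_card; rewrite subUset BnA andbT.
  by apply/subsetP => x; rewrite inE => /andP[].
- have QE : Q \subset (fun x => [set v; x]) @: Rn :|: trace_sets r Bn [set v].
    apply/subsetP => e eQ; have := hs e eQ => /orP[/eqP e2|er].
      rewrite inE; apply/orP; left.
      have c1 : #|e :&: A| = 1.
        by have := cardsID A e; rewrite (hQ _ eQ) cards1; lia.
      case/eqP/cards1P: c1 => x hx.
      have Ee : e = [set v; x] by rewrite -(setID e A) (hQ _ eQ) hx setUC.
      apply/imsetP; exists x => //; rewrite inE -Ee eQ andbT.
      by have := set11 x; rewrite -hx inE => /andP[].
    rewrite inE; apply/orP; right; rewrite inE er /=.
    apply/eqP/setP => x; rewrite inE.
    have := hQ _ eQ => /setP/(_ x); rewrite !inE => <-.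
    have [xe|] := boolP (x \in e); last by rewrite !andbF.
    rewrite !andbT; congr negb; apply/idP/idP; first by move/(subsetP BnA).
    by move=> xA; apply/bigcupP; exists e; rewrite !inE ?eQ ?xe.
  apply: leq_trans (subset_leq_card QE) _.
  apply: leq_trans (leq_card_setU _ _) _.
  apply: leq_add; first exact: leq_imset_card.
  rewrite card_trace_sets ?cards1 ?subn1 //; last by lia.
  by rewrite disjoints1; apply: contraNN vA; apply: (subsetP BnA).
move=> Bc; have BE : Bn = A by apply/eqP; rewrite eqEcard BnA Bc leqnn.
apply/subsetP => e eQ; rewrite inE (hQ _ eQ) eqxx andbT.
case/orP: (hs e eQ) => // /eqP e2.
have c1 : #|e :&: A| = 1.
  by have := cardsID A e; rewrite (hQ _ eQ) cards1; lia.
case/eqP/cards1P: c1 => x hx.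
have Ee : e = [set v; x] by rewrite -(setID e A) (hQ _ eQ) hx setUC.
have xA : x \in A by have := set11 x; rewrite -hx inE => /andP[].
have : x \in Rn by rewrite inE xA -Ee.
by move=> /(disjointFr dis); rewrite BE xA.
Qed.

End Traces.

(** * Paths, connectivity and weights in vertex subsets *)

Lemma longest_seq (T : finType) (P : pred (seq T)) s0 b :
    P s0 -> (forall s, P s -> size s <= b) ->
  exists s, P s /\ forall s', P s' -> size s' <= size s.
Proof.
move=> Ps0 Pb.
pose Q n := [exists t : n.-tuple T, P t].
have exQ : exists n, Q n.
  by exists (size s0); apply/existsP; exists (in_tuple s0).
have leQ n : Q n -> n <= b by case/existsP => t /Pb; rewrite size_tuple.
case: (ex_maxnP exQ leQ) => n /existsP[t Pt] max; exists t; split=> // s' Ps'.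
by rewrite size_tuple; apply: max; apply/existsP; exists (in_tuple s').
Qed.

Section Graph.
Variables (T : finType) (g : rel T).
Hypothesis gsym : symmetric g.
Implicit Types (V W U X S C e : {set T}) (x y u v : T) (s : seq T).

Definition induced V : rel T := fun x y => [&& x \in V, y \in V & g x y].

Lemma induced_sym V : symmetric (induced V).
Proof. by move=> x y; rewrite /induced gsym andbCA. Qed.

Lemma connect_induced_sym V : connect_sym (induced V).
Proof. exact: sym_connect_sym (induced_sym V). Qed.

Lemma connect_induced_sub V W x y : V \subset W -> connect (induced V) x y -> connect (induced W) x y.
Proof.
move=> /subsetP VW; apply: connect_sub => a b /and3P[aV bV ab].
by apply: connect1; rewrite /induced !VW.
Qed.

Definition connected_in V : Prop := V != set0 /\ {in V &, forall x y, connect (induced V) x y}.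

Lemma conn_from V u : u \in V -> (forall y, y \in V -> connect (induced V) u y) -> connected_in V.
Proof.
move=> uV h; split; first by apply/set0Pn; exists u.
by move=> x y xV yV; rewrite (connect_trans _ (h y yV)) // connect_induced_sym h.
Qed.

(** Simple paths. The start [x] is kept apart from [s], so [size s] is the length in edges. *)
Definition gpath V x s := [&& all (fun z => z \in V) (x :: s), path g x s & uniq (x :: s)].

Definition nopath V k := forall x s, gpath V x s -> size s < k.

Lemma gpath_nil V x : gpath V x [::] = (x \in V).
Proof. by rewrite /gpath /= !andbT. Qed.

Lemma gpath_sub V W x s : V \subset W -> gpath V x s -> gpath W x s.
Proof.
move=> /subsetP VW /and3P[aV pv uv]; rewrite /gpath pv uv !andbT.
by apply/allP => z /(allP aV) /VW.
Qed.

Lemma nopath_sub V W k : V \subset W -> nopath W k -> nopath V k.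
Proof. by move=> VW h x s /(gpath_sub VW); apply: h. Qed.

Lemma gpath_rcons V x s y : gpath V x (rcons s y) =
  [&& gpath V x s, y \in V, g (last x s) y & y \notin x :: s].
Proof.
rewrite /gpath -rcons_cons all_rcons rcons_path rcons_uniq.
case: (y \in V); case: (all (fun z => z \in V) (x :: s)); case: (path g x s);
by case: (g _ y); case: (uniq (x :: s)); case: (y \in x :: s).
Qed.

Lemma gpath_in V x s z : gpath V x s -> z \in x :: s -> z \in V.
Proof. by case/and3P => /allP h _ _; apply: h. Qed.

Lemma gpath_size V x s : gpath V x s -> size s < #|V|.
Proof.
case/and3P => h _ us; rewrite -[(size s).+1]/(size (x :: s)).
by rewrite -(card_uniqP us); apply: subset_leq_card; apply/subsetP => z /(allP h).
Qed.

Lemma connect_gpath V x y : x \in V -> connect (induced V) x y ->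
  exists s, gpath V x s /\ last x s = y.
Proof.
move=> xV /connectP[p pp ->]; case/shortenP: pp => p' pp' up' _.
exists p'; split => //; rewrite /gpath up' andbT.
elim: p' x xV pp' {up'} => [|z p' IH] x xV /=; first by rewrite xV.
case/andP=> /and3P[_ zV xz] /(IH _ zV) /andP[/= a b].
by rewrite xV xz /= a b.
Qed.

Lemma gpath_connect V x s z : gpath V x s -> z \in x :: s -> connect (induced V) x z.
Proof.
case/and3P => h ps _; elim: s x h ps z => [|y s IH] x /=.
  by move=> _ _ z; rewrite inE => /eqP->; apply: connect0.
case/and3P=> xV yV h /andP[xy ps] z; rewrite inE => /orP[/eqP->|zs].
  exact: connect0.
apply: connect_trans (IH y _ ps z zs); last by rewrite /= yV.
by apply: connect1; rewrite /induced xV yV.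
Qed.

(** A path from [u] that runs through [v] leaves it at a neighbour of [v], which by assumption is
    reached from [u] without [v]. *)
Lemma conn_del V u v : connected_in V -> u \in V -> v \in V -> u != v ->
    (forall y, y \in V -> y != v -> g v y -> connect (induced (V :\ v)) u y) -> connected_in (V :\ v).
Proof.
move=> [_ cV] uV vV uv h.
have uV' : u \in V :\ v by rewrite !inE uv.
apply: (conn_from uV') => y; rewrite !inE => /andP[yv yV].
have [s [gs Es]] := connect_gpath uV (cV u y uV yV).
have {gs} [aV ps] : all (fun z => z \in V) (u :: s) /\ path g u s by case/and3P: gs.
move: yv; rewrite -{}Es => yv {yV}.
elim/last_ind: s aV ps yv => [|s z IH]; first by move=> *; apply: connect0.
rewrite last_rcons -rcons_cons all_rcons rcons_path => /andP[zV aV] /andP[ps lz] zv.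
have [E|lv] := eqVneq (last u s) v; first by apply: h => //; rewrite -E.
apply: connect_trans (IH aV ps lv) _; apply: connect1.
by rewrite /induced !inE lv zv zV lz (allP aV) // mem_last.
Qed.

Definition neighbours V v : {set T} := [set x in V | g v x].

Section Weight.
Variables (r : nat) (M : {set {set T}}).
Hypothesis r3 : 2 < r.
Hypothesis mixM : mixed r M.
Hypothesis girr : irreflexive g.
Hypothesis cliqueM : forall e x y, e \in M -> x \in e -> y \in e -> x != y -> g x y.

Definition weight V := #|[set e in M | e \subset V]|.

Definition incident V v := [set e in M | (e \subset V) && (v \in e)].

Lemma weight_del V v : weight V = weight (V :\ v) + #|incident V v|.
Proof.
rewrite /weight -(cardsID [set e : {set T} | v \in e]) addnC; congr (_ + _); apply: eq_card => e.
  by rewrite !inE subsetD1; case: (e \in M); case: (e \subset V); case: (v \in e).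
by rewrite !inE andbA.
Qed.

Lemma incident_trace V v e : e \in incident V v -> e :\: neighbours V v = [set v].
Proof.
rewrite inE => /and3P[eM /subsetP eV ve]; apply/setP => x; rewrite !inE.
have [->|xv] := eqVneq x v; first by rewrite girr andbF.
apply/negbTE; rewrite negb_and negbK.
have [xe|] := boolP (x \in e); last by rewrite orbT.
by rewrite eV // (cliqueM eM ve xe) // eq_sym.
Qed.

Lemma incident_mixed V v : mixed r (incident V v).
Proof. by apply: mixed_sub mixM; apply/subsetP => e; rewrite inE => /andP[]. Qed.

Lemma neighbours_irr V v : v \notin neighbours V v.
Proof. by rewrite inE girr andbF. Qed.

(** The bound of [link_bound] over all splits of [p] neighbours into [a] red and [b] blue ones. It
    is abstract in [p] and [L] because it is used with [m] and [D], with [m.-1] and [D.-1], and with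
    the crude [k] and [k + 'C(k, r.-1)]. *)
Definition degree_weight p L := forall a b, a + b <= p -> a + 'C(b, r.-1) <= L.

Lemma incident_le V v p L : degree_weight p L -> #|neighbours V v| <= p -> #|incident V v| <= L.
Proof.
move=> hL hp.
have [a [b [ab h _]]] := link_bound r3 (incident_mixed V v) (neighbours_irr V v) (@incident_trace V v).
by apply: leq_trans h _; apply: hL; apply: leq_trans ab hp.
Qed.

Lemma weight_set1 u : weight [set u] = 0.
Proof.
apply/eqP; rewrite cards_eq0; apply/eqP/setP => e; rewrite !inE.
apply/negP => /andP[eM /subset_leq_card]; rewrite cards1.
by case/orP: (proj1 mixM _ eM) => /eqP ->; lia.
Qed.

(* The far end of a longest path from [u] is not a cut vertex and its neighbours all lie on the path. *)
Lemma rooted_peel V u p L : degree_weight p L -> connected_in V -> u \in V ->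
    (forall s, gpath V u s -> size s <= p) -> weight V <= L * (#|V|.-1).
Proof.
move=> hL; move En: #|V| => n; elim: n V En => [|n IH] V En cV uV hp.
  by move/eqP: En; rewrite cards_eq0 => /eqP E; rewrite E inE in uV.
have P0 : gpath V u [::] by rewrite gpath_nil.
have [s [gs max]] := longest_seq P0 hp.
have [E|lu] := eqVneq (last u s) u.
  have s0 : s = [::].
    case/lastP: s gs max E => // s z + _; rewrite last_rcons => + E.
    by rewrite gpath_rcons E inE eqxx /= !andbF.
  suff -> : V = [set u] by rewrite weight_set1.
  apply/eqP; rewrite eqEsubset sub1set uV andbT; apply/subsetP => y yV; rewrite inE.
  have [t [gt Et]] := connect_gpath uV (proj2 cV _ _ uV yV).
  by have := max t gt; rewrite s0 /= leqn0 -Et => /nilP ->.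
have h1 : neighbours V (last u s) \subset [set z in belast u s].
  apply/subsetP => y; rewrite !inE => /andP[yV ly].
  have : y \in u :: s.
    apply/negPn/negP => ys; have /max : gpath V u (rcons s y).
      by rewrite gpath_rcons gs yV ly.
    by rewrite size_rcons ltnn.
  rewrite lastI mem_rcons inE => /orP[/eqP E|//].
  by move: ly; rewrite -E girr.
have hc : connected_in (V :\ last u s).
  apply: (conn_del cV uV) => //.
  - by apply: (gpath_in gs); apply: mem_last.
  - by rewrite eq_sym.
  move=> y yV yl ly; have : y \in neighbours V (last u s) by rewrite inE yV.
  move/(subsetP h1); rewrite inE.
  case/lastP: s gs lu {max h1 ly yl} => [|s z]; first by rewrite eqxx.
  rewrite last_rcons gpath_rcons belast_rcons => /and4P[gs zV lz zs] zu.
  apply: gpath_connect; case/and3P: gs => aV ps us; rewrite /gpath ps us !andbT.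
  apply/allP => x xs; rewrite !inE (allP aV) // andbT.
  by apply: contraNneq zs => <-.
have lV : last u s \in V by apply: (gpath_in gs); apply: mem_last.
have En' : #|V :\ last u s| = n by have := cardsD1 (last u s) V; rewrite lV; lia.
have uV' : u \in V :\ last u s by rewrite !inE eq_sym lu.
have IH' : weight (V :\ last u s) <= L * n.-1.
  apply: IH => // t gt; apply: hp; apply: gpath_sub gt; exact: subD1set.
have h2 : #|incident V (last u s)| <= L.
  apply: (incident_le hL); apply: leq_trans (subset_leq_card h1) _.
  apply: leq_trans (hp _ gs).
  by rewrite cardsE; apply: leq_trans (card_size _) _; rewrite size_belast.
rewrite (weight_del V (last u s)); have : 0 < n by rewrite -En'; apply/card_gt0P; exists u.
case: n {IH En En'} IH' => // n IH' _; by rewrite /= mulnS addnC; apply: leq_add.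
Qed.

End Weight.
End Graph.

(** * Components attached to a small vertex set *)

Lemma subset_card_between (T : finType) (A B : {set T}) n :
    A \subset B -> #|A| <= n <= #|B| -> exists F : {set T}, [/\ A \subset F, F \subset B & #|F| = n].
Proof.
move=> AB; elim: n => [|n IH] /andP[An nB].
  by exists A; split=> //; lia.
have [An'|An'] := leqP #|A| n; last by exists A; split=> //; lia.
have [|F [AF FB cF]] := IH; first by rewrite An' ltnW.
have /subsetPn[x xB xF] : ~~ (B \subset F).
  by apply/negP => /subset_leq_card; rewrite cF; lia.
exists (x |: F); split; first by apply: subset_trans AF (subsetUr _ _).
  by rewrite subUset sub1set xB.
by rewrite cardsU1 xF cF.
Qed.

(** Here [p] bounds the paths from a root and [K] is the number of components wanted. Fewer than [K]
    components besides the root, whence the successor, leave one with more than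
    [attach_bound p' (2 * K)] vertices; [2 * K] components are asked of it because up to half may be
    lost. *)
Fixpoint attach_bound (p K : nat) : nat :=
  if p is p'.+1 then (K * attach_bound p' (2 * K)).+1 else 0.

Section Components.
Variables (T : finType) (g : rel T).
Hypothesis gsym : symmetric g.
Hypothesis girr : irreflexive g.
Implicit Types (V W U X S C e : {set T}) (F : {set {set T}}) (x y u v : T) (s : seq T).

Lemma gpath_cons V x y s : gpath g V x (y :: s) =
  [&& x \in V, g x y, x \notin y :: s & gpath g V y s].
Proof.
rewrite /gpath /=; case: (x \in V); case: (y \in V); case: (all _ s); case: (g x y) => //=;
by case: (path g y s); case: (x \notin y :: s) => //=; rewrite ?andbF.
Qed.

Lemma gpath_cat V x s1 s2 : gpath g V x (s1 ++ s2) =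
  [&& gpath g V x s1, gpath g V (last x s1) s2 & ~~ has (fun z => z \in x :: s1) s2].
Proof.
elim/last_ind: s2 => [|s z IH].
  rewrite cats0 gpath_nil /= andbT; case E: (gpath g V x s1) => //=.
  by rewrite (gpath_in E) // mem_last.
rewrite -rcons_cat !gpath_rcons IH last_cat has_rcons -cat_cons mem_cat negb_or.
rewrite (negb_or (z \in x :: s1)) (in_cons (last x s1)).
case E: (gpath g V x s1) => //=.
have [H|H] := boolP (z \in x :: s1); rewrite ?andbF //=.
have -> : (z == last x s1) = false.
  by apply: contraNF H => /eqP->; apply: mem_last.
by case: (gpath g V _ s); case: (has _ s); case: (z \in V); case: (g _ z); case: (z \in s).
Qed.

Lemma rev_cons_belast x s : last x s :: rev (belast x s) = rev (x :: s).
Proof. by rewrite (lastI x s) rev_rcons. Qed.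

Lemma gpath_rev V x s : gpath g V x s -> gpath g V (last x s) (rev (belast x s)).
Proof.
case/and3P => aV ps us; rewrite /gpath rev_cons_belast all_rev rev_uniq aV us andbT /=.
by rewrite rev_path (eq_path (e' := g)) // => a b; rewrite gsym.
Qed.

Lemma conn_closed_sub C W x : connected_in g C -> x \in C -> x \in W ->
  (forall a b, a \in W -> a \in C -> b \in C -> g a b -> b \in W) -> C \subset W.
Proof.
move=> [_ cC] xC xW h; apply/subsetP => y yC.
have [s [gs <-]] := connect_gpath xC (cC x y xC yC).
elim/last_ind: s gs => [|s z IH] //; rewrite gpath_rcons last_rcons.
case/and4P=> gs zC lz _; apply: h zC lz; first exact: IH.
by apply: (gpath_in gs); apply: mem_last.
Qed.

(** Connectedness and closure make [C] a whole component of [V :\: S]. This form, rather than an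
    equation with [component], carries over when [V] grows, and possibly [S] with it, as in
    [many_attached]. *)
Definition attached V S C : Prop :=
  [/\ C \subset V :\: S, connected_in g C,
      forall x y, x \in C -> y \in V -> g x y -> y \in C :|: S
    & forall a, a \in S -> exists2 c, c \in C & g a c].

Lemma attached_eq V S C C' x : attached V S C -> attached V S C' ->
  x \in C -> x \in C' -> C = C'.
Proof.
move=> [s1 c1 n1 _] [s2 c2 n2 _] xC xC'; apply/eqP; rewrite eqEsubset.
apply/andP; split.
  apply: (conn_closed_sub c1 xC xC') => a b a' aC bC ab.
  have /setDP[bV bS] := subsetP s1 _ bC.
  by have := n2 a b a' bV ab; rewrite inE (negbTE bS) orbF.
apply: (conn_closed_sub c2 xC' xC) => a b a' aC bC ab.
have /setDP[bV bS] := subsetP s2 _ bC.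
by have := n1 a b a' bV ab; rewrite inE (negbTE bS) orbF.
Qed.

Definition component W x := [set y | connect (induced g W) x y].

Lemma component_sub W x : x \in W -> component W x \subset W.
Proof.
move=> xW; apply/subsetP => y; rewrite inE => /(connect_gpath xW) [s [gs <-]].
by apply: (gpath_in gs); apply: mem_last.
Qed.

Lemma component_conn W x : x \in W -> connected_in g (component W x).
Proof.
move=> xW; apply: (conn_from gsym (u := x)); first by rewrite inE connect0.
move=> y; rewrite inE => /(connect_gpath xW) [s [gs <-]].
apply: (@gpath_connect _ _ _ _ s); last exact: mem_last.
case/and3P: (gs) => aV ps us; rewrite /gpath ps us !andbT.
by apply/allP => z /(gpath_connect gs); rewrite inE.
Qed.

Lemma component_closed W x a b : a \in component W x -> a \in W -> b \in W -> g a b ->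
  b \in component W x.
Proof.
rewrite !inE => xa aW bW ab; apply: connect_trans xa (connect1 _).
by rewrite /induced aW bW.
Qed.

Lemma component_link V u x : connected_in g V -> u \in V -> x \in V :\ u ->
  exists2 c, c \in component (V :\ u) x & g u c.
Proof.
move=> [_ cV] uV xW; have /setD1P[xu xV] := xW.
have [[|c s] [gs Es]] := connect_gpath uV (cV u x uV xV).
  by move: xu; rewrite -Es eqxx.
case/and3P: gs => /= /and3P[_ cV' aV] /andP[uc ps] /andP[us us'].
exists c => //; rewrite inE connect_induced_sym // -Es /=.
apply: (@gpath_connect _ _ _ _ s); last exact: mem_last.
apply/and3P; split=> //; apply/allP => z zs.
rewrite !inE; apply/andP; split; first by apply: contraNneq us => <-.
by move: zs; rewrite inE => /orP[/eqP->|/(allP aV)].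
Qed.

(* Remove the root [u]: either many components remain, or a large one with shorter paths does. *)
Lemma many_attached p K V u : connected_in g V -> u \in V ->
    (forall s, gpath g V u s -> size s < p) -> attach_bound p K < #|V| ->
  exists S F, [/\ S != set0, S \subset V, K <= #|F| & forall C, C \in F -> attached V S C].
Proof.
elim: p K V u => [|p IH] K V u cV uV hp.
  by have := hp [::]; rewrite gpath_nil uV => /(_ isT).
rewrite /=; move: (attach_bound p (2 * K)) (IH (2 * K)) => N' {}IH hN.
pose W := V :\ u; pose P := [set component W x | x in W].
have cW : #|V| = #|W|.+1 by rewrite (cardsD1 u V) uV.
have attP x : x \in W -> attached V [set u] (component W x).
  move=> xW; split; [exact: component_sub | exact: component_conn | |].
    move=> a b aC bV ab; rewrite inE in_set1 orbC.
    have [//|bu] := eqVneq b u; apply: component_closed ab => //.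
      exact: (subsetP (component_sub xW)).
    by rewrite !inE bu.
  by move=> a /set1P->; apply: component_link.
have [KP|PK] := leqP K #|P|.
  exists [set u], P; split=> //; first by apply/set0Pn; exists u; rewrite inE.
    by rewrite sub1set.
  by move=> C /imsetP[x xW ->]; apply: attP.
have /exists_inP[C CP NC] : [exists C in P, N' < #|C|].
  apply: contraT => /exists_inPn h; suff : false by [].
  have : #|W| <= #|cover P|.
    apply: subset_leq_card; apply/subsetP => x xW; apply/bigcupP.
    by exists (component W x); rewrite ?inE ?connect0 //; apply/imsetP; exists x.
  have := leq_card_cover P => h1 h2.
  have h3 : \sum_(A in P) #|A| <= \sum_(A in P) N'.
    by apply: leq_sum => A AP; rewrite leqNgt h.
  have := leq_trans h2 (leq_trans (leq_of_leqif h1) h3); rewrite sum_nat_const => h4.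
  have : #|P| * N' <= K * N' by rewrite leq_mul2r (ltnW PK) orbT.
  by move: h4 cW hN; clear; lia.
case/imsetP: CP => x xW EC.
have [sC cC nC aC] := attP x xW; rewrite -EC in sC cC nC aC.
have [u' u'C uu'] := aC u (set11 u).
have CV : C \subset V by apply: subset_trans sC (subsetDl _ _).
have uC : u \notin C by apply/negP => /(subsetP sC); rewrite !inE eqxx.
have [|S [F [S0 SC KF aF]]] := IH C u' cC u'C _ NC.
  move=> t gt; have := hp (u' :: t); rewrite ltnS; apply.
  rewrite gpath_cons uV uu' (gpath_sub CV gt) andbT /=.
  by apply: contraNN uC; apply: gpath_in gt.
have SV := subset_trans SC CV.
(* Of the [2 * K] components at least [K] see [u], and then [u] joins [S], or at least [K] do not,
   and these have no new neighbour in [V]. *)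
pose Fu := [set C' in F | [exists c in C', g u c]].
have cF : #|F| = #|Fu| + #|F :\: Fu|.
  rewrite -(cardsID Fu F); congr (_ + _); apply: eq_card => C'.
  by rewrite !inE andbA andbb.
have closedF C' y z : C' \in F -> y \in C' -> z \in V -> z != u -> g y z -> z \in C' :|: S.
  move=> C'F yC' zV zu yz; have [s1 _ n1 _] := aF _ C'F.
  have yC : y \in C by case/setDP: (subsetP s1 _ yC').
  apply: n1 (yz) => //; have := nC y z yC zV yz.
  by rewrite inE in_set1 (negbTE zu) orbF.
have uC' C' : C' \in F -> u \notin C'.
  move=> /aF[s1 _ _ _]; apply: contraNN uC => /(subsetP s1).
  by case/setDP.
have [KFu|KFu] := leqP K #|Fu|.
  exists (u |: S), Fu; split=> //.
  - by apply/set0Pn; exists u; rewrite setU11.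
  - by rewrite subUset sub1set uV.
  move=> C'; rewrite inE => /andP[C'F /exists_inP[c cC' uc]].
  have [s1 c1 n1 a1] := aF _ C'F; split=> //.
  - apply/subsetP => y yC'; have /setDP[yC yS] := subsetP s1 _ yC'.
    rewrite !inE (negbTE yS) orbF (subsetP CV) // andbT.
    by apply: contraNneq (uC' _ C'F) => <-.
  - move=> y z yC' zV yz; rewrite setUCA !inE; have [//|zu] := eqVneq z u.
    by have := closedF _ _ _ C'F yC' zV zu yz; rewrite inE.
  - by move=> a /setU1P[->|/a1 //]; exists c.
exists S, (F :\: Fu); split=> //.
  by move: KF KFu; rewrite cF; clear; move: #|Fu| #|_ :\: _| => q1 q2; lia.
move=> C' /setDP[C'F]; rewrite inE C'F /= => /exists_inPn hu.
have [s1 c1 n1 a1] := aF _ C'F; split=> //.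
- apply/subsetP => y yC'; have /setDP[yC yS] := subsetP s1 _ yC'.
  by rewrite !inE yS (subsetP CV).
move=> y z yC' zV yz; apply: closedF (yz) => //.
by apply: contraTneq yz => ->; rewrite gsym hu.
Qed.

(** Consecutive vertices of [x :: xs] are joined through a fresh component each, at a cost of at
    least two edges. The last clause locates the vertices of the path, so that other paths can be
    glued to it. *)
Lemma zigzag V S F x xs : S \subset V -> (forall C, C \in F -> attached V S C) ->
    {subset x :: xs <= S} -> uniq (x :: xs) -> size xs <= #|F| ->
  exists s, [/\ gpath g V x s, last x s = last x xs, 2 * size xs <= size s &
    forall z, z \in s -> z \in xs \/ exists2 C, C \in F & z \in C].
Proof.
move=> SV; elim: xs x F => [|y xs IH] x F aF sS ux szF.
  by exists [::]; rewrite gpath_nil (subsetP SV) ?sS ?inE.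
have /card_gt0P[C CF] : 0 < #|F| by apply: leq_trans szF.
have [sC cC nC aC] := aF _ CF.
have [c cc xc] := aC x (sS x (mem_head _ _)).
have yS : y \in S by apply: sS; rewrite !inE eqxx orbT.
have [c' cc' yc'] := aC y yS.
have [t [gt Et]] := connect_gpath cc (proj2 cC _ _ cc cc').
have [|||  |s [gs Es hs ss]] := IH y (F :\ C).
- by move=> C' /setD1P[_ /aF].
- by move=> z zs; apply: sS; rewrite inE zs orbT.
- by case/andP: ux.
- by move: szF; rewrite (cardsD1 C F) CF /= add1n ltnS.
have CV : C \subset V by apply: subset_trans sC (subsetDl _ _).
have SC z : z \in S -> z \notin C.
  by move=> zS; apply/negP => /(subsetP sC); rewrite inE zS.
have xS : x \in S by apply: sS; rewrite mem_head.
have sout z : z \in s -> z \notin x :: c :: t.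
  move=> zs; apply/negP; rewrite -[_ :: _]/([:: x] ++ _) mem_cat inE.
  case: (ss z zs) => [zxs|[C' /setD1P[C'C C'F] zC']] /orP[/eqP E|zt].
  - by move: ux; rewrite /= -E inE zxs orbT.
  - have : z \in C by apply: (gpath_in gt).
    by apply/negP; apply: SC; apply: sS; rewrite !inE zxs !orbT.
  - have [s1 _ _ _] := aF _ C'F.
    by have := subsetP s1 _ zC'; rewrite inE E xS.
  - have zC : z \in C by apply: (gpath_in gt).
    by rewrite (attached_eq (aF _ CF) (aF _ C'F) zC zC') eqxx in C'C.
have gc : gpath g V x (c :: t).
  rewrite gpath_cons (subsetP SV) // xc (gpath_sub CV gt) andbT /=.
  by apply: contraNN (SC x xS); apply: gpath_in gt.
exists (c :: t ++ y :: s); split.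
- rewrite -cat_cons gpath_cat gc /= Et gpath_cons (subsetP CV) // gsym yc' gs.
  have yC := SC y yS; have yc : y != c' by apply: contraNneq yC => ->.
  rewrite inE eq_sym negb_or yc /= andbT negb_or; apply/and3P; split.
  + by apply/negP => /sout; rewrite -Et in_cons mem_last orbT.
  + apply: contraNN yC => yx; move: ux; rewrite /= inE negb_or eq_sym => /andP[/andP[yx' _] _].
    by move: yx; rewrite inE (negbTE yx') /=; apply: gpath_in gt.
  + by apply/hasPn => z /sout.
- by rewrite /= last_cat.
- by move: hs; rewrite /= size_cat /=; clear; lia.
move=> z; rewrite -cat_cons mem_cat inE => /orP[zt|/orP[/eqP->|zs]].
- by right; exists C => //; apply: (gpath_in gt).
- by left; rewrite inE eqxx.
case: (ss z zs) => [zxs|[C' /setD1P[_ C'F] zC']]; first by left; rewrite inE zxs orbT.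
by right; exists C'.
Qed.

(** The path is [s1] backwards to [a], a zigzag through all of [S1] from [a] to [b], then [s2]. The
    case [a = b] is the empty zigzag and is allowed only when [S1] is a single vertex. *)
Lemma long_path V S F S1 a b s1 s2 : S \subset V -> (forall C, C \in F -> attached V S C) ->
    S1 \subset S -> a \in S1 -> b \in S1 -> (a == b -> #|S1| = 1) -> #|S1| <= #|F|.+1 ->
    gpath g V a s1 -> gpath g V b s2 -> (forall z, z \in s1 -> z \notin s2) ->
    (forall z, z \in s1 ++ s2 -> z \notin S) ->
    (forall z C, z \in s1 ++ s2 -> C \in F -> z \notin C) ->
  exists x s, gpath g V x s /\ size s1 + size s2 + 2 * #|S1|.-1 <= size s.
Proof.
move=> SV aF S1S aS bS abS cF g1 g2 d12 nS nF.
have [xs [sxs uxs Exs lxs]] : exists xs, [/\ {subset a :: xs <= S1}, uniq (a :: xs),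
    size xs = #|S1|.-1 & last a xs = b].
  have [E|ab] := eqVneq a b.
    exists [::]; split=> //; first by move=> z; rewrite inE => /eqP->.
    by rewrite (abS _) // E.
  exists (rcons (enum (S1 :\ a :\ b)) b); split.
  - move=> z; rewrite inE mem_rcons inE mem_enum !inE.
    by case/or3P => [/eqP->|/eqP->|/and3P[]].
  - by rewrite /= rcons_uniq enum_uniq mem_rcons inE !mem_enum !inE !eqxx (negbTE ab) !andbF.
  - rewrite size_rcons -cardE; have := cardsD1 a S1; have := cardsD1 b (S1 :\ a).
    by rewrite !inE aS bS eq_sym ab /=; clear; lia.
  - by rewrite last_rcons.
have [||s [gs ls hs ss]] := zigzag (x := a) (xs := xs) SV aF _ uxs.
  by move=> z /sxs /(subsetP S1S).
  by move: cF; rewrite Exs; clear; lia.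
have g1' := gpath_rev g1.
have l1 : last (last a s1) (rev (belast a s1)) = a.
  by case: s1 {g1 d12 nS nF g1'} => //= y s1; rewrite rev_cons last_rcons.
have souts z : z \in s -> z \notin s1 ++ s2.
  move=> zs; apply/negP => z12; case: (ss z zs) => [zxs|[C CF zC]].
    by have := nS z z12; rewrite (subsetP S1S) // sxs // inE zxs orbT.
  by have := nF z C z12 CF; rewrite zC.
have ga2 : gpath g V a (s ++ s2).
  rewrite gpath_cat gs ls lxs g2 /=; apply/hasPn => z z2.
  rewrite inE negb_or; apply/andP; split.
    have : z \notin S by apply: nS; rewrite mem_cat z2 orbT.
    by apply: contraNneq => ->; apply: (subsetP S1S).
  by apply: contraTN z2 => /souts; rewrite mem_cat negb_or => /andP[].
exists (last a s1), (rev (belast a s1) ++ (s ++ s2)); split.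
  rewrite gpath_cat g1' l1 ga2 /= rev_cons_belast; apply/hasPn => z zs.
  rewrite mem_rev inE negb_or; apply/andP; split.
    case/and3P: ga2 => _ _ /= /andP[+ _]; by apply: contraNneq => <-.
  apply/negP => z1; move: zs; rewrite mem_cat => /orP[/souts|].
    by rewrite mem_cat z1.
  by apply/negP; apply: d12.
by move: hs Exs; rewrite !size_cat size_rev size_belast; clear; lia.
Qed.

End Components.

(** * Irreducible vertex sets *)

Section Irreducible.
Variables (T : finType) (g : rel T).
Hypothesis gsym : symmetric g.
Hypothesis girr : irreflexive g.
Variables (r m : nat) (M : {set {set T}}).
Hypothesis r3 : 2 < r.
Hypothesis rm : r + 6 <= m.
Hypothesis mixM : mixed r M.
Hypothesis cliqueM : forall (e : {set T}) x y, e \in M -> x \in e -> y \in e -> x != y -> g x y.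
Implicit Types (V W U X S C e : {set T}) (F : {set {set T}}) (x y u v b : T) (s : seq T).

Let D := 'C(m, r.-1).

Lemma bin_gap_link (b : nat) : b < m -> 'C(b, r.-1) + (m - b) < D.
Proof.
rewrite /D; have -> : r.-1 = (r - 2).+1 by move: r3; clear; lia.
by apply: bin_gap; move: r3 rm; clear; lia.
Qed.

Lemma degree_weight_m : degree_weight r m D.
Proof.
move=> a b ab; have [/bin_gap_link|mb] := ltnP b m; first by move: ab; clear; lia.
by have [-> ->] : b = m /\ a = 0 by move: mb ab; clear; lia.
Qed.

Lemma degree_weight_pred : degree_weight r m.-1 D.-1.
Proof.
move=> a b ab; have : b < m by move: ab rm; clear; lia.
by move/bin_gap_link; move: ab; clear; lia.
Qed.

Lemma incident_lt V v : #|neighbours g V v| < m -> #|incident M V v| < D.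
Proof.
move=> hd; have D0 : 0 < D by rewrite bin_gt0; move: r3 rm; clear; lia.
rewrite -(prednK D0) ltnS.
by apply: (incident_le r3 mixM girr cliqueM degree_weight_pred); move: hd; clear; lia.
Qed.

(** The equality case of [incident_le]: by strictness in [bin_gap], reaching [D] needs [m] blue
    neighbours and no red one, so every [r]-set made of [v] and neighbours of [v] is a member. *)
Lemma incident_full V v : #|neighbours g V v| <= m -> D <= #|incident M V v| ->
  #|neighbours g V v| = m /\ incident M V v = trace_sets r (neighbours g V v) [set v].
Proof.
move=> hd hD; have [/incident_lt|hm] := ltnP #|neighbours g V v| m; first by rewrite ltnNge hD.
have E : #|neighbours g V v| = m by apply/eqP; rewrite eqn_leq hd.
split=> //.
have [a [b [ab hb]]] := link_bound r3 (incident_mixed mixM V v) (neighbours_irr girr V v)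
  (@incident_trace _ _ _ girr cliqueM V v).
have bm : b = #|neighbours g V v|.
  have [/bin_gap_link|] := ltnP b m; last by move: ab E; clear; lia.
  by move: ab hb hD; rewrite E; clear; lia.
move/(_ bm) => sub; apply/eqP; rewrite eqEcard sub card_trace_sets ?cards1 ?E ?subn1 //.
  by rewrite disjoints1 neighbours_irr.
by move: r3; clear; lia.
Qed.

(** Minimality under the deletions of the peeling. Size one yields minimum degrees at vertices that
    are not cut vertices; size two is used in [longest_branch] against the last two vertices of a
    path. *)
Definition irreducible V := forall X, X \subset V -> X != set0 -> #|X| <= 2 ->
  connected_in g (V :\: X) -> weight M (V :\: X) + D * #|X| <= weight M V.

Lemma irreducible_deg V v : irreducible V -> v \in V -> connected_in g (V :\ v) -> D <= #|incident M V v|.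
Proof.
move=> irrV vV cV; have := irrV [set v]; rewrite sub1set cards1 muln1 (weight_del M V v).
move/(_ vV _ _ cV); rewrite leq_add2l; apply=> //.
by apply/set0Pn; exists v; rewrite inE.
Qed.

Lemma irreducible_neighbours V v : irreducible V -> v \in V -> connected_in g (V :\ v) -> m <= #|neighbours g V v|.
Proof.
move=> irrV vV cV; rewrite leqNgt; apply/negP => /incident_lt.
by rewrite ltnNge irreducible_deg.
Qed.

Lemma branch_neighbours V S C b s v : attached g V S C -> b \in S ->
    gpath g V b (rcons s v) -> {subset rcons s v <= C} ->
    (forall s', gpath g V b s' && all (fun z => z \in C) s' -> size s' <= (size s).+1) ->
  neighbours g V v \subset S :|: [set z in s].
Proof.
move=> [sC cC nC aC] bS gs sCs max; apply/subsetP => y; rewrite inE => /andP[yV vy].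
have vC : v \in C by apply: sCs; rewrite mem_rcons mem_head.
have := nC v y vC yV vy; rewrite !inE orbC; have [//|yS /=] := boolP (y \in S) => yC.
apply: contraT => ys.
have : gpath g V b (rcons (rcons s v) y) && all (fun z => z \in C) (rcons (rcons s v) y).
  rewrite gpath_rcons gs yV last_rcons vy /= all_rcons yC; apply/andP; split.
    rewrite inE mem_rcons inE !negb_or ys andbT; apply/andP; split.
      by apply: contraNneq yS => ->.
    by apply: contraTneq vy => ->; rewrite girr.
  by apply/allP => z /sCs.
by move/max; rewrite !size_rcons ltnn.
Qed.

(** Without [v], its neighbours on the path stay joined to [b] by the path, and those in [S] by the
    second component [C'], which [v] does not meet. The set [U] is [V], or [V] with one vertex
    already deleted. *)
Lemma branch_conn V U S C' b s v : attached g V S C' -> v \notin S -> v \notin C' ->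
    connected_in g U -> U \subset V -> S \subset U -> C' \subset U -> b \in S -> v \in U ->
    gpath g U b s -> v \notin s -> neighbours g U v \subset S :|: [set z in s] -> connected_in g (U :\ v).
Proof.
move=> aC' vS vC' cU UV SU C'U bS vU gs vs nv.
have [_ cC' _ lC'] := aC'.
have bv : b != v by apply: contraNneq vS => <-.
apply: (conn_del gsym cU _ vU bv); first by rewrite (subsetP SU).
move=> y yU yv vy.
have : y \in neighbours g U v by rewrite inE yU.
move/(subsetP nv); rewrite !inE => /orP[yS|ys].
  have [c cc bc] := lC' _ bS; have [c' cc' yc'] := lC' _ yS.
  have C'U' : C' \subset U :\ v by rewrite subsetD1 C'U.
  have inU z : z \in S -> z \in U :\ v.
    by move=> zS; rewrite !inE (subsetP SU) // andbT; apply: contraNneq vS => <-.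
  apply: (@connect_trans _ _ c); first by apply: connect1; apply/and3P; split; [exact: inU|exact: (subsetP C'U')|].
  apply: (@connect_trans _ _ c').
    by apply: connect_induced_sub C'U' _; apply: (proj2 cC').
  by apply: connect1; apply/and3P; split; [exact: (subsetP C'U')|exact: inU|rewrite gsym].
apply: (@gpath_connect _ _ _ _ s); last by rewrite inE ys orbT.
case/and3P: gs => aU ps us; rewrite /gpath ps us !andbT.
apply/allP => z zs; rewrite !inE (allP aU) // andbT.
by apply: contraTneq zs => ->; rewrite inE negb_or eq_sym bv.
Qed.

(* The end of a longest path from [b] into [C] is not a cut vertex, so by irreducibility it has
   at least [m] neighbours, all of which lie in [S] or on the path. *)
Lemma longest_branch V S C C' b : connected_in g V -> irreducible V -> S \subset V -> #|S| <= m -> b \in S ->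
    attached g V S C -> attached g V S C' -> C != C' ->
  exists s, [/\ gpath g V b s, {subset s <= C}, m < #|S| + size s &
    #|S| + size s <= m.+1 ->
      #|S| = m /\ exists2 c, C = [set c] & trace_sets r S [set c] \subset M].
Proof.
move=> cV irrV SV Sm bS aC aC' CC'.
have [sC cC nC lC] := aC; have [sC' cC' _ _] := aC'.
pose P s := gpath g V b s && all (fun z => z \in C) s.
have CV : C \subset V by apply: subset_trans sC (subsetDl _ _).
have C'V : C' \subset V by apply: subset_trans sC' (subsetDl _ _).
have CS z : z \in C -> z \notin S by case/(subsetP sC)/setDP.
have bV : b \in V by apply: (subsetP SV).
have P0 : P [::] by rewrite /P gpath_nil bV.
have Pb s : P s -> size s <= #|V| by case/andP => /gpath_size /ltnW.
have [s [Ps max]] := longest_seq P0 Pb.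
have [c cc bc] := lC _ bS.
have Pc : P [:: c].
  rewrite /P gpath_cons bV bc gpath_nil (subsetP CV) //= inE cc !andbT.
  by apply: contraTneq cc => <-; apply: contraL bS; apply: CS.
case/lastP: s Ps max => [|s v] Ps max; first by have := max _ Pc.
case/andP: (Ps) => gs /allP sCs.
have vC : v \in C by apply: sCs; rewrite mem_rcons mem_head.
have vV := subsetP CV _ vC.
have max' s' : gpath g V b s' && all (fun z => z \in C) s' -> size s' <= (size s).+1.
  by move/max; rewrite size_rcons.
have nv := branch_neighbours aC bS gs sCs max'.
have [gs0 _ _ vs] := and4P (etrans (esym (gpath_rcons g V b s v)) gs).
have vs' : v \notin s by move: vs; rewrite inE negb_or => /andP[].
have CC'0 z : z \in C -> z \notin C'.
  by move=> zC; apply: contraNN CC' => zC'; rewrite (attached_eq aC aC' zC zC').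
have vS : v \notin S by apply: CS.
have vC' := CC'0 v vC.
have cVv := branch_conn aC' vS vC' cV (subxx V) SV C'V bS vV gs0 vs' nv.
have degv := irreducible_neighbours irrV vV cVv.
have Dv := irreducible_deg irrV vV cVv.
have cs : #|S :|: [set z in s]| <= #|S| + size s.
  apply: leq_trans (leq_card_setU _ _) _; rewrite leq_add2l cardsE; exact: card_size.
have cnv := leq_trans (subset_leq_card nv) cs.
exists (rcons s v); split=> //; first by rewrite size_rcons addnS ltnS (leq_trans degv).
rewrite size_rcons addnS ltnS => small.
have [Ev incv] := incident_full (leq_trans cnv small) Dv.
have Env : neighbours g V v = S :|: [set z in s].
  by apply/eqP; rewrite eqEcard nv Ev (leq_trans cs small).
have trM : trace_sets r (neighbours g V v) [set v] \subset M.
  by rewrite -incv; apply/subsetP => e; rewrite inE => /andP[].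
case/lastP: s => [|s v'] in Ps gs sCs max max' nv gs0 vs vs' cs cnv small Env *.
  have NS : neighbours g V v = S by rewrite Env; apply/setP => z; rewrite !inE orbF.
  split; first by rewrite -NS.
  exists v; last by rewrite -NS.
  apply/eqP; rewrite eqEsubset sub1set vC andbT.
  apply: (conn_closed_sub cC vC); first by rewrite inE.
  move=> x y /set1P-> _ yC vy; have : y \in neighbours g V v by rewrite inE vy (subsetP CV).
  by rewrite NS (negbTE (CS y yC)).
(* The path now ends in [v'], [v]. As [v] is adjacent to all of [S] and to the whole path, these two
   vertices can be swapped, which confines the neighbours of [v'] in the same way. After deleting
   [v], fewer than [m] of them remain, so [v] and [v'] together meet fewer than [2 * D] members,
   against irreducibility. *)
exfalso.
have v'v : v' != v by apply: contraNneq vs' => <-; rewrite mem_rcons mem_head.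
have v'N : v' \in neighbours g V v by rewrite Env !inE mem_rcons mem_head orbT.
have v'C : v' \in C by apply: sCs; rewrite mem_rcons inE mem_rcons mem_head orbT.
have v'V := subsetP CV _ v'C.
have [gs1 _ _ v's] := and4P (etrans (esym (gpath_rcons g V b s v')) gs0).
have clq x y : x \in neighbours g V v -> y \in neighbours g V v -> x != y -> g x y.
  move=> xN yN xy.
  have [||f [xyf fN cf]] := @subset_card_between _ [set x; y] (neighbours g V v) r.-1.
  - by rewrite subUset !sub1set xN.
  - by rewrite cards2 xy Ev; move: r3 rm; clear; lia.
  have vf : v \notin f by apply: contraNN (neighbours_irr girr V v); apply: (subsetP fN).
  have fM : v |: f \in M.
    apply: (subsetP trM); rewrite inE cardsU1 vf cf; apply/andP; split.
      by apply/eqP; move: r3; clear; lia.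
    apply/eqP/setP => z; rewrite !inE; have [->|zv /=] := eqVneq z v.
      by rewrite girr andbF.
    by apply/negbTE; rewrite negb_and negbK; case zf : (z \in f); rewrite ?orbT //;
       move/(subsetP fN): zf; rewrite inE => ->.
  by apply: (cliqueM fM) => //; rewrite in_setU (subsetP xyf) ?orbT // !inE eqxx ?orbT.
have lastN : last b s \in neighbours g V v.
  rewrite Env in_setU; case/lastP: (s) => [|s1 z]; first by rewrite bS.
  by rewrite last_rcons orbC inE mem_rcons inE mem_rcons mem_head orbT.
have lastv' : last b s != v' by apply: contraNneq v's => <-; apply: mem_last.
have gsv : gpath g V b (rcons s v).
  rewrite gpath_rcons gs1 vV /=; apply/andP; split.
    by move: lastN; rewrite inE gsym => /andP[].
  by apply: contraNN vs; rewrite !inE mem_rcons inE => /orP[->|->]; rewrite ?orbT.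
have vs1 : v \notin b :: s.
  by apply: contraNN vs; rewrite !inE mem_rcons inE => /orP[->|->]; rewrite ?orbT.
have gsvv : gpath g V b (rcons (rcons s v) v').
  rewrite gpath_rcons gsv v'V last_rcons; move: v'N; rewrite inE => /andP[_ ->] /=.
  by move: v's; rewrite !inE mem_rcons inE (negbTE v'v).
have sC1 : {subset rcons (rcons s v) v' <= C}.
  by move=> z; rewrite mem_rcons inE mem_rcons inE orbCA => zz; apply: sCs;
  rewrite mem_rcons inE mem_rcons inE.
have max1 s' : gpath g V b s' && all (fun z => z \in C) s' -> size s' <= (size (rcons s v)).+1.
  by move/max'; rewrite !size_rcons.
have nv' := branch_neighbours aC bS gsvv sC1 max1.
have UV : V :\ v \subset V by apply: subD1set.
have v's1 : v' \notin s by move: v's; rewrite inE negb_or => /andP[].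
have nU : neighbours g (V :\ v) v' \subset S :|: [set z in s].
  apply/subsetP => z; rewrite !inE => /andP[/andP[zv zV] vz].
  have : z \in neighbours g V v' by rewrite inE zV.
  by move/(subsetP nv'); rewrite !inE mem_rcons inE (negbTE zv).
have v'S : v' \notin S by apply: CS.
have v'C' := CC'0 v' v'C.
have cU : connected_in g ((V :\ v) :\ v').
  apply: (branch_conn aC' v'S v'C' cVv UV _ _ bS _ _ v's1 nU).
  - by rewrite subsetD1 SV.
  - by rewrite subsetD1 C'V.
  - by rewrite !inE v'v.
  case/and3P: gs1 => aV ps us; rewrite /gpath ps us !andbT.
  by apply/allP => z zs; rewrite !inE (allP aV) // andbT; apply: contraNneq vs1 => <-.
have nlt : #|neighbours g (V :\ v) v'| < m.
  apply: leq_ltn_trans (subset_leq_card nU) _.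
  apply: leq_ltn_trans (leq_card_setU _ _) _; rewrite cardsE.
  apply: leq_ltn_trans (_ : _ <= #|S| + size s) _; first by rewrite leq_add2l card_size.
  by move: small; rewrite size_rcons addnS.
have := irrV [set v; v']; rewrite subUset !sub1set vV v'V cards2 (eq_sym v) v'v => /(_ isT).
have -> : V :\: [set v; v'] = (V :\ v) :\ v'.
  by apply/setP => z; rewrite !inE; case: (z == v); case: (z == v').
have -> : [set v; v'] != set0 by apply/set0Pn; exists v; rewrite !inE eqxx.
move/(_ isT isT cU); rewrite (weight_del M V v) (weight_del M (V :\ v) v').
have := incident_lt nlt; have := incident_le r3 mixM girr cliqueM degree_weight_m (leq_trans cnv small).
by rewrite -/D; clear; lia.
Qed.

End Irreducible.

(** * Extremal families and the common attachment set *)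

Section TraceCount.
Variable T : finType.
Implicit Types (V S Y e : {set T}) (Q : {set {set T}}) (x y v : T).

Implicit Types (ev : bool).

(** Together with [extremal] this is [Hnk] freed of concrete vertices: [S] plays the part of [A],
    [x] and [y] those of the two special vertices, and [ev] says that [k] is even. Listing the
    possible parts outside [S] lets the count and the comparison with [M] run trace by trace. *)
Definition traces ev V S x y : {set {set T}} :=
  set0 |: ([set [set v] | v in V :\: S] :|: (if ev then [set [set x; y]] else set0)).

Definition extremal (r : nat) ev V S x y : {set {set T}} :=
  [set e : {set T} | (#|e| == r) && (e :\: S \in traces ev V S x y)].

Lemma in_extremal r ev V S x y e :
  (e \in extremal r ev V S x y) = (#|e| == r) && (e :\: S \in traces ev V S x y).
Proof. by rewrite inE. Qed.

Lemma card_traces_sum Q ev V S x y : (forall e, e \in Q -> e :\: S \in traces ev V S x y) ->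
  #|Q| = \sum_(Y in traces ev V S x y) #|[set e in Q | e :\: S == Y]|.
Proof.
move=> hQ; rewrite -sum1_card (partition_big (fun e => e :\: S) (mem (traces ev V S x y))) //=.
apply: eq_bigr => Y _; rewrite -sum1_card; apply: eq_bigl => e; by rewrite inE.
Qed.

Lemma card_extremal r ev V S x y : 2 < r -> S \subset V ->
    x \in V :\: S -> y \in V :\: S -> x != y ->
  #|extremal r ev V S x y| =
    'C(#|S|, r - 1) * (#|V| - #|S|) + 'C(#|S|, r) + ev * 'C(#|S|, r - 2).
Proof.
move=> r3 SV /setDP[xV xS] /setDP[yV yS] xy.
rewrite (@card_traces_sum _ ev V S x y); last by move=> e; rewrite inE => /andP[].
have E Y : Y \in traces ev V S x y ->
    #|[set e in extremal r ev V S x y | e :\: S == Y]| = #|trace_sets r S Y|.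
  move=> hY; apply: eq_card => e; rewrite in_set in_extremal -andbA [RHS]in_set; congr (_ && _).
  by apply: andb_idl => /eqP->.
rewrite (eq_bigr (fun Y => #|trace_sets r S Y|)) => [|Y /E //].
rewrite big_setU1 /=; last first.
  rewrite inE negb_or; apply/andP; split.
    by apply/imsetP => -[v _ /setP/(_ v)]; rewrite !inE eqxx.
  case: ev {E}; rewrite !inE //.
  by apply/eqP => /setP/(_ x); rewrite !inE eqxx.
have d0 : [disjoint (set0 : {set T}) & S] by rewrite -setI_eq0 set0I.
rewrite card_trace_sets ?cards0 ?subn0 //.
rewrite (eq_bigl [in [predU [set [set v] | v in V :\: S]
  & (if ev then [set [set x; y]] else set0)]]); last by move=> Y; rewrite !inE.
rewrite bigU /=; last first.
  apply/pred0P => Y /=; apply/negP => /andP[/imsetP[v _ ->]].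
  case: ev {E}; rewrite !inE // => /eqP /(congr1 (fun A : {set T} => #|A|)).
  by rewrite cards1 cards2 xy.
rewrite big_imset /=; last by move=> u v _ _; apply: set1_inj.
rewrite (eq_bigr (fun _ => 'C(#|S|, r - 1))) => [|v /setDP[_ vS]]; last first.
  rewrite card_trace_sets ?cards1 //; last by move: r3; clear; lia.
  by rewrite disjoints1.
rewrite sum_nat_const cardsD (setIidPr SV).
have -> : \sum_(i in (if ev then [set [set x; y]] else set0)) #|trace_sets r S i| = ev * 'C(#|S|, r - 2).
  case: ev {E}; last by rewrite big_set0.
  rewrite big_set1 card_trace_sets ?cards2 ?xy ?mul1n //; last by move: r3; clear; lia.
  apply/pred0P => z /=; rewrite !inE; apply/negP => /andP[/orP[]/eqP->].
    exact/negP.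
  exact/negP.
by rewrite mulnC; clear; lia.
Qed.

End TraceCount.

Section Structure.
Variables (T : finType) (g : rel T).
Hypothesis gsym : symmetric g.
Hypothesis girr : irreflexive g.
Variables (r m : nat) (M : {set {set T}}).
Hypothesis r3 : 2 < r.
Hypothesis rm : r + 6 <= m.
Hypothesis mixM : mixed r M.
Hypothesis cliqueM : forall (e : {set T}) x y, e \in M -> x \in e -> y \in e -> x != y -> g x y.
Implicit Types (V W U X S C e : {set T}) (F : {set {set T}}) (x y u v a b : T) (s : seq T).

Let D := 'C(m, r.-1).

Definition full_singleton S C := [exists c, (C == [set c]) && (trace_sets r S [set c] \subset M)].

Lemma two_of_nonempty S : S != set0 -> exists a b, [/\ a \in S, b \in S & a == b -> #|S| = 1].
Proof.
case/set0Pn => a aS; have [E|] := eqVneq (S :\ a) set0.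
  by exists a, a; split=> //; rewrite (cardsD1 a S) aS E cards0.
case/set0Pn => b /setD1P[ba bS]; exists a, b; split=> //.
by rewrite eq_sym (negbTE ba).
Qed.

(** A zigzag through [m + 1] vertices of [S] has [2 * m] edges, and one more edge at each end
    reaches [2 * m + 2 >= k]; hence [#|S| <= m]. Longest branches satisfy [#|S| + size s >= m + 1].
    If both sums were at least [m + 2] for two components, then [size s1 + size s2 + 2 * (#|S| - 1)]
    would again reach [2 * m + 2]. So one of any two components is tight, and [longest_branch] makes
    it a full singleton and gives [#|S| = m]. *)
Lemma attached_leaves V S F k : connected_in g V -> irreducible g r m M V -> S \subset V -> S != set0 ->
    (forall C, C \in F -> attached g V S C) -> m + 3 <= #|F| -> nopath g V k -> k <= 2 * m + 2 ->
  #|S| = m /\ exists F', [/\ F' \subset F, #|F| <= #|F'|.+1 & forall C, C \in F' -> full_singleton S C].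
Proof.
move=> cV irrV SV S0 aF cF np hk.
have CS C z : C \in F -> z \in C -> z \notin S.
  by move=> /aF[sC _ _ _] /(subsetP sC) /setDP[].
have CV C z : C \in F -> z \in C -> z \in V.
  by move=> /aF[sC _ _ _] /(subsetP sC) /setDP[].
have key S1 a b C1 C2 s1 s2 : S1 \subset S -> a \in S1 -> b \in S1 -> (a == b -> #|S1| = 1) ->
    #|S1| <= m.+1 -> C1 \in F -> C2 \in F -> C1 != C2 -> gpath g V a s1 -> gpath g V b s2 ->
    {subset s1 <= C1} -> {subset s2 <= C2} -> size s1 + size s2 + 2 * #|S1|.-1 < k.
  move=> S1S aS bS abS cS1 C1F C2F C12 g1 g2 sC1 sC2.
  have [|||||||z [s [gs hs]]] := @long_path _ g gsym V S (F :\ C1 :\ C2) S1 a b s1 s2 SV _ S1S aS bS abS.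
  - by move=> C /setD1P[_ /setD1P[_ /aF]].
  - have C2F1 : C2 \in F :\ C1 by rewrite !inE eq_sym C12.
    by move: cF cS1; rewrite (cardsD1 C1 F) (cardsD1 C2 (F :\ C1)) C1F C2F1 !add1n addn3 !ltnS => h1 h2; apply: leq_trans h2 (leqW _).
  - exact: g1.
  - exact: g2.
  - move=> z /sC1 z1; apply/negP => /sC2 z2.
    by case/eqP: C12; apply: (attached_eq (aF _ C1F) (aF _ C2F) z1 z2).
  - by move=> z; rewrite mem_cat => /orP[/sC1|/sC2]; apply: CS.
  - move=> z C; rewrite mem_cat => /orP[/sC1|/sC2] zC' /setD1P[C2' /setD1P[C1' CF]];
      apply/negP => zC.
      by case/eqP: C1'; apply: (attached_eq (aF _ CF) (aF _ C1F) zC zC').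
    by case/eqP: C2'; apply: (attached_eq (aF _ CF) (aF _ C2F) zC zC').
  by apply: leq_ltn_trans hs _; apply: np gs.
have Sm : #|S| <= m.
  rewrite leqNgt; apply/negP => mS.
  have [|S1 [_ S1S c1]] := @subset_card_between _ set0 S m.+1 (sub0set _).
    by rewrite cards0.
  have [|a [b [aS bS ab]]] := @two_of_nonempty S1.
    by rewrite -card_gt0 c1.
  have /card_gt0P[C1 C1F] : 0 < #|F| by move: cF; clear; lia.
  have /card_gt0P[C2 /setD1P[C21 C2F]] : 0 < #|F :\ C1|.
    by move: cF; rewrite (cardsD1 C1 F) C1F add1n; clear; lia.
  have [_ _ _ l1] := aF _ C1F; have [_ _ _ l2] := aF _ C2F.
  have [c1' cc1 ac1] := l1 a (subsetP S1S _ aS); have [c2' cc2 bc2] := l2 b (subsetP S1S _ bS).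
  have step a' c' C : a' \in S1 -> c' \in C -> C \in F -> g a' c' -> gpath g V a' [:: c'].
    move=> aS' cC CF ac; have aS1 := subsetP S1S _ aS'.
    rewrite gpath_cons gpath_nil (subsetP SV _ aS1) ac (CV _ _ CF cC) inE andbT /=.
    by apply: contraNneq (CS _ _ CF cC) => <-.
  have := @key S1 a b C1 C2 [:: c1'] [:: c2'] S1S aS bS ab _ C1F C2F _ (step _ _ _ aS cc1 C1F ac1)
    (step _ _ _ bS cc2 C2F bc2).
  rewrite c1 eq_sym C21 => /(_ (leqnn _) isT) H.
  have : size [:: c1'] + size [:: c2'] + 2 * m.+1.-1 < k.
    by apply: H => z; rewrite inE => /eqP->.
  by move: hk => /=; clear; lia.
have [a [b [aS bS ab]]] := two_of_nonempty S0.
have good C1 C2 : C1 \in F -> C2 \in F -> C1 != C2 ->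
    #|S| = m /\ (full_singleton S C1 \/ full_singleton S C2).
  move=> C1F C2F C12; have C21 : C2 != C1 by rewrite eq_sym.
  have [s1 [g1 sC1 l1 h1]] := longest_branch gsym girr r3 rm mixM cliqueM cV irrV SV Sm aS (aF _ C1F) (aF _ C2F) C12.
  have [s2 [g2 sC2 l2 h2]] := longest_branch gsym girr r3 rm mixM cliqueM cV irrV SV Sm bS (aF _ C2F) (aF _ C1F) C21.
  have sum := key S a b C1 C2 s1 s2 (subxx S) aS bS ab (leqW Sm) C1F C2F C12 g1 g2 sC1 sC2.
  have leafI C c : C = [set c] -> trace_sets r S [set c] \subset M -> full_singleton S C.
    by move=> -> hc; apply/existsP; exists c; rewrite eqxx.
  have S1 : 0 < #|S| by rewrite card_gt0.
  have [/h1[Em [c Ec cM]]|q1] := leqP (#|S| + size s1) m.+1.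
    by split=> //; left; apply: leafI Ec cM.
  have [/h2[Em [c Ec cM]]|q2] := leqP (#|S| + size s2) m.+1.
    by split=> //; right; apply: leafI Ec cM.
  by move: sum q1 q2 hk S1; clear; lia.
split.
  have /card_gt0P[C1 C1F] : 0 < #|F| by move: cF; clear; lia.
  have /card_gt0P[C2 /setD1P[C21 C2F]] : 0 < #|F :\ C1|.
    by move: cF; rewrite (cardsD1 C1 F) C1F add1n; clear; lia.
  by have [] := good C2 C1 C2F C1F C21.
exists [set C in F | full_singleton S C]; split.
- by apply/subsetP => C; rewrite inE => /andP[].
- have : #|F :\: [set C in F | full_singleton S C]| <= 1.
    apply/card_le1_eqP => C1 C2; rewrite !inE => /andP[+ C1F] /andP[+ C2F].
    rewrite C1F C2F /= => n1 n2; apply/eqP; apply: contraT; rewrite eq_sym => C12.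
    by have [_ [h|h]] := good _ _ C1F C2F C12; rewrite h in n1 n2.
  have := cardsID [set C in F | full_singleton S C] F.
  have -> : F :&: [set C in F | full_singleton S C] = [set C in F | full_singleton S C].
    by apply/setIidPr/subsetP => C; rewrite inE => /andP[].
  by clear; lia.
by move=> C; rewrite inE => /andP[].
Qed.

End Structure.

(** * Edges outside the attachment set *)

Section Outside.
Variables (T : finType) (g : rel T).
Hypothesis gsym : symmetric g.
Hypothesis girr : irreflexive g.
Variables (r m k : nat) (M : {set {set T}}).
Hypothesis r3 : 2 < r.
Hypothesis rm : r + 6 <= m.
Hypothesis mixM : mixed r M.
Hypothesis cliqueM : forall (e : {set T}) x y, e \in M -> x \in e -> y \in e -> x != y -> g x y.
Implicit Types (V W U X S C e : {set T}) (F : {set {set T}}) (x y u v a b : T) (s : seq T).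

Let D := 'C(m, r.-1).

Variables (V S : {set T}) (F : {set {set T}}).
Hypothesis cV : connected_in g V.
Hypothesis irrV : irreducible g r m M V.
Hypothesis SV : S \subset V.
Hypothesis Sm : #|S| = m.
Hypothesis aF : forall C, C \in F -> attached g V S C.
Hypothesis lF : forall C, C \in F -> full_singleton r M S C.
Hypothesis cF : m + 2 <= #|F|.
Hypothesis np : nopath g V k.

(** A leaf has neighbours only in [S], while on a path with at least two vertices outside [S] each
    of them is next to another one. Hence all leaves stay free for the zigzag. *)
Lemma leaf_avoid a s z C : C \in F -> a \in S -> gpath g V a s ->
  {in s, forall y, y \notin S} -> 2 <= size s -> z \in s -> z \notin C.
Proof.
move=> CF aS gs sS s2 zs; apply/negP => zC.
have [_ _ nC _] := aF CF; have /existsP[c /andP[/eqP EC _]] := lF CF.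
have stuck y : y \in s -> g z y -> False.
  move=> ys zy; have yV : y \in V by apply: (gpath_in gs); rewrite inE ys orbT.
  have := nC z y zC yV zy; rewrite inE (negbTE (sS _ ys)) orbF => yC.
  by move: zC yC zy; rewrite EC !inE => /eqP-> /eqP->; rewrite girr.
case/and3P: gs => _ ps _.
case/splitPr: zs ps stuck s2 {sS} => s1 s2'; rewrite cat_path /= => /and3P[_ lz pz] stuck.
case: s2' pz stuck => [|y s2'] /= pz stuck.
  case/lastP: s1 lz stuck => [|s1 y] lz stuck // _.
  apply: (stuck y); first by rewrite mem_cat mem_rcons mem_head.
  by rewrite gsym; move: lz; rewrite last_rcons.
case/andP: pz => zy _ _; apply: (stuck y) => //.
by rewrite mem_cat !inE eqxx !orbT.
Qed.

Lemma outside_two a b s1 s2 : a \in S -> b \in S -> a != b ->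
  gpath g V a s1 -> gpath g V b s2 -> 2 <= size s1 -> 2 <= size s2 ->
  {in s1 ++ s2, forall y, y \notin S} -> {in s1, forall y, y \notin s2} ->
  size s1 + size s2 + 2 * m.-1 < k.
Proof.
move=> aS bS ab g1 g2 h1 h2 nS d12.
have n1 : {in s1, forall y, y \notin S} by move=> y ys; apply: nS; rewrite mem_cat ys.
have n2 : {in s2, forall y, y \notin S} by move=> y ys; apply: nS; rewrite mem_cat ys orbT.
have [|||z [s [gs hs]]] := long_path gsym SV aF (subxx S) aS bS _ _ g1 g2 d12 nS.
- by rewrite (negbTE ab).
- by rewrite Sm; move: cF; clear; lia.
- move=> z C; rewrite mem_cat => /orP[] zs CF.
    exact: leaf_avoid CF aS g1 n1 h1 zs.
  exact: leaf_avoid CF bS g2 n2 h2 zs.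
by rewrite -Sm; apply: leq_ltn_trans hs (np gs).
Qed.

Lemma two_le_S a : exists2 b, b \in S & a != b.
Proof.
have /card_gt0P[b /setD1P[ba bS]] : 0 < #|S :\ a|.
  have := cardsD1 a S; rewrite Sm; case: (a \in S) => /=; move: r3 rm; clear; lia.
by exists b; rewrite // eq_sym.
Qed.

(** The other end of the zigzag through [S] is prolonged by one edge into a leaf, which accounts for
    the [+ 1]. *)
Lemma outside_one a s : a \in S -> gpath g V a s -> {in s, forall y, y \notin S} ->
  2 <= size s -> size s + 2 * m.-1 + 1 < k.
Proof.
move=> aS gs sS s2.
have [b bS ab] := two_le_S a.
have /card_gt0P[C CF] : 0 < #|F| by move: cF; clear; lia.
have [sC _ _ lC] := aF CF; have [c cC bc] := lC b bS.
have /setDP[cV' cS] := subsetP sC _ cC.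
have g2 : gpath g V b [:: c].
  rewrite gpath_cons gpath_nil (subsetP SV _ bS) bc cV' inE andbT /=.
  by apply: contraNneq cS => <-.
have [||||||z [t [gt ht]]] := @long_path _ g gsym V S (F :\ C) S a b s [:: c] SV _ (subxx S) aS bS _ _ gs g2.
- by move=> C' /setD1P[_ /aF].
- by rewrite (negbTE ab).
- by rewrite Sm; move: cF; rewrite (cardsD1 C F) CF add1n addn2 ltnS => /ltnW h; apply: leqW.
- move=> z zs; rewrite inE; apply: contraNneq (leaf_avoid CF aS gs sS s2 zs) => ->.
  exact: cC.
- by move=> z; rewrite mem_cat inE => /orP[/sS //|/eqP->].
- move=> z C'; rewrite mem_cat inE => /orP[zs|/eqP->] /setD1P[C'C C'F].
    exact: leaf_avoid C'F aS gs sS s2 zs.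
  by apply: contraNN C'C => cC'; rewrite (attached_eq (aF CF) (aF C'F) cC cC').
by move: (np gt) ht; rewrite Sm /=; clear; lia.
Qed.

(** Follow a path from [S] to [x] inside the component of [x]. If it misses [y], append [y];
    otherwise cut it at [y] and append [x]. The order in which the edge is traversed is therefore
    not under control. *)
Lemma reach_outside_edge x y : x \in V :\: S -> y \in V :\: S -> g x y ->
  exists a s u v, [/\ a \in S, gpath g V a (rcons (rcons s u) v),
    {in rcons (rcons s u) v, forall z, z \notin S} & (u = x /\ v = y) \/ (u = y /\ v = x)].
Proof.
move=> xO yO xy; pose C := component g (V :\: S) x.
have xC : x \in C by rewrite inE connect0.
have CO : C \subset V :\: S by apply: component_sub.
have cC : connected_in g C by apply: component_conn.
have [a aS [c cC' ac]] : exists2 a, a \in S & exists2 c, c \in C & g a c.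
  have [/exists_inP[a aS /exists_inP[c cC' ac]]|/exists_inPn h] :=
    boolP [exists a in S, [exists c in C, g a c]].
    by exists a => //; exists c.
  have [a aS _] := two_le_S x.
  have VC : V \subset C.
    apply: (conn_closed_sub cV _ xC); first by case/setDP: xO.
    move=> u v uC _ vV uv; have [vS|vS] := boolP (v \in S).
      have := h _ vS; rewrite negb_exists => /forallP /(_ u).
      by rewrite uC gsym uv.
    apply: component_closed uv => //; first exact: (subsetP CO).
    by rewrite inE vS.
  by have := subsetP CO _ (subsetP VC _ (subsetP SV _ aS)); rewrite inE aS.
have [t [gt Et]] := connect_gpath cC' (proj2 cC _ _ cC' xC).
have CV z : z \in C -> z \in V by move/(subsetP CO)/setDP => [].
have CS z : z \in C -> z \notin S by move/(subsetP CO)/setDP => [].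
have ext s : gpath g C c s -> gpath g V a (c :: s).
  move=> gs; rewrite gpath_cons (subsetP SV _ aS) ac (gpath_sub _ gs) ?andbT /=.
    by apply: contraL aS => /(gpath_in gs) /CS.
  by apply/subsetP.
have fin s u v : gpath g C c s -> last c s = u -> v \in C -> v \notin c :: s -> g u v ->
    (u = x /\ v = y) \/ (u = y /\ v = x) ->
    exists a s u v, [/\ a \in S, gpath g V a (rcons (rcons s u) v),
    {in rcons (rcons s u) v, forall z, z \notin S} & (u = x /\ v = y) \/ (u = y /\ v = x)].
  move=> gs Es vC vs uv huv; have gsv : gpath g C c (rcons s v).
    by rewrite gpath_rcons gs vC Es uv.
  have E : c :: rcons s v = rcons (rcons (belast c s) u) v by rewrite -rcons_cons lastI Es.
  exists a, (belast c s), u, v; split=> //; first by rewrite -E; apply: ext.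
  by move=> z; rewrite -E => /(gpath_in gsv) /CS.
have yC : y \in C.
  by apply: component_closed xy => //; rewrite (subsetP CO).
have [yt|yt] := boolP (y \in c :: t); last by apply: (fin t x y) => //; left.
have xyN : x != y by apply: contraTneq xy => ->; rewrite girr.
case/splitPl: yt gt Et => t1 t2 Ey; rewrite gpath_cat last_cat => /and3P[g1 g2 d2] Ex.
apply: (fin t1 y x) => //; [|by rewrite gsym|by right].
case/lastP: t2 Ex d2 {g2} => [|t2 z] /=; first by rewrite Ey => E; rewrite E eqxx in xyN.
by rewrite last_rcons has_rcons negb_or => -> /andP[].
Qed.

Lemma odd_no_edge x y : k = (2 * m).+1 -> x \in V :\: S -> y \in V :\: S -> ~~ g x y.
Proof.
move=> kE xO yO; apply/negP => xy; have [a [s [u [v [aS gs sS _]]]]] := reach_outside_edge xO yO xy.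
have := outside_one aS gs sS; rewrite !size_rcons kE => /(_ isT).
by move: rm; clear; lia.
Qed.

Hypothesis kE : k = 2 * m + 2.

Lemma short_outside a s : a \in S -> gpath g V a s -> {in s, forall z, z \notin S} -> size s <= 2.
Proof.
move=> aS gs sS; rewrite leqNgt; apply/negP => s2.
by have := outside_one aS gs sS (ltnW s2); move: s2 rm; rewrite kE; clear; lia.
Qed.

(** A neighbour of [v] outside [S] other than [u] would give a path with three vertices outside [S].
    So [v] is no cut vertex, and irreducibility supplies the degree. *)
Lemma path_end_neighbours a u v : a \in S -> gpath g V a [:: u; v] -> u \notin S -> v \notin S ->
  neighbours g V v \subset u |: S /\ m <= #|neighbours g V v|.
Proof.
move=> aS gs uS vS.
have sS : {in [:: u; v], forall z, z \notin S}.
  by move=> z; rewrite !inE => /orP[/eqP->|/eqP->].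
have nv : neighbours g V v \subset u |: S.
  apply/subsetP => z; rewrite !inE => /andP[zV vz].
  apply: contraT; rewrite negb_or => /andP[zu zS].
  have gz : gpath g V a [:: u; v; z].
    rewrite -[[:: u; v; z]]/(rcons [:: u; v] z) gpath_rcons gs zV vz !inE !negb_or zu /=.
    apply/andP; split; first by apply: contraNneq zS => ->.
    by apply: contraTneq vz => ->; rewrite girr.
  suff : 3 <= 2 by [].
  apply: (short_outside aS gz) => y.
  by rewrite !inE => /or3P[]/eqP->.
split=> //; apply: (irreducible_neighbours girr r3 rm mixM cliqueM irrV).
  by apply: (gpath_in gs); rewrite !inE eqxx !orbT.
have /card_gt0P[C CF] : 0 < #|F| by move: cF; clear; lia.
have vC : v \notin C by apply: (leaf_avoid CF aS gs sS) => //; rewrite !inE eqxx orbT.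
have CV : C \subset V by have [sC _ _ _] := aF CF; apply: subset_trans sC (subsetDl _ _).
have vV : v \in V by apply: (gpath_in gs); rewrite !inE eqxx !orbT.
move: gs; rewrite -[[:: u; v]]/(rcons [:: u] v) gpath_rcons => /and4P[g1 _ _ vu].
have nv' : neighbours g V v \subset S :|: [set z in [:: u]].
  by apply: subset_trans nv _; apply/subsetP => z; rewrite !inE orbC.
apply: (branch_conn gsym (aF CF) vS vC cV (subxx V) SV CV aS vV g1 _ nv').
by move: vu; rewrite !inE negb_or => /andP[].
Qed.

(** Entering the edge from [S] settles only its far end. That end has [m] neighbours, hence one in
    [S], and entering from there settles the other end. *)
Lemma outside_edge x y : x \in V :\: S -> y \in V :\: S -> g x y ->
  [/\ neighbours g V x \subset y |: S, m <= #|neighbours g V x|,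
      neighbours g V y \subset x |: S & m <= #|neighbours g V y|].
Proof.
move=> xO yO xy.
have [a [s [u [v [aS gs sS uv]]]]] := reach_outside_edge xO yO xy.
have Es : s = [::].
  by have := short_outside aS gs sS; rewrite !size_rcons; case: s {gs sS}.
rewrite Es /= in gs sS.
have uS : u \notin S by apply: sS; rewrite mem_head.
have vS : v \notin S by apply: sS; rewrite !inE eqxx orbT.
have [nv dv] := path_end_neighbours aS gs uS vS.
have /subsetPn[b bN bu] : ~~ (neighbours g V v \subset [set u]).
  by apply/negP => /subset_leq_card; rewrite cards1; move: dv rm; clear; lia.
have bS : b \in S by have := subsetP nv _ bN; rewrite !inE in bu *; rewrite (negbTE bu).
move: gs; rewrite !gpath_cons !gpath_nil => /and4P[aV au _ /and4P[uV uv' uvN vV]].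
have gs' : gpath g V b [:: v; u].
  have uv1 : u != v by move: uvN; rewrite inE.
  have bv : g b v by move: bN; rewrite inE gsym => /andP[].
  rewrite !gpath_cons gpath_nil (subsetP SV _ bS) uV vV (gsym v u) uv' !inE negb_or bv.
  rewrite (eq_sym v) uv1 !andbT /=.
  by apply/andP; split; [apply: contraNneq vS => <- | apply: contraNneq uS => <-].
have [nu du] := path_end_neighbours bS gs' vS uS.
by case: uv => [[<- <-]|[<- <-]]; split.
Qed.

Lemma outside_S x y z : neighbours g V x \subset y |: S -> m <= #|neighbours g V x| ->
  exists a, [/\ a \in S, g a x & a != z].
Proof.
move=> nx dx; have /subsetPn[a aN] : ~~ (neighbours g V x \subset [set y; z]).
  apply/negP => /subset_leq_card; rewrite cards2; move: dx rm; clear.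
  by case: (_ != _) => /=; lia.
rewrite !inE negb_or => /andP[ay az]; exists a.
have := subsetP nx _ aN; rewrite !inE (negbTE ay) /= => ->; split=> //.
by move: aN; rewrite inE gsym => /andP[].
Qed.

(** Two outside edges cannot share just one end, since [outside_edge] confines the neighbours of
    both ends. Two disjoint ones, entered from different vertices of [S], give length
    [2 + 2 + 2 * (m - 1) = k]. *)
Lemma one_outside_edge x y x' y' : x \in V :\: S -> y \in V :\: S -> g x y ->
  x' \in V :\: S -> y' \in V :\: S -> g x' y' -> x' \in [set x; y].
Proof.
move=> xO yO xy xO' yO' xy'; apply: contraT; rewrite !inE negb_or => /andP[x'x x'y].
have [nx dx ny dy] := outside_edge xO yO xy.
have [nx' dx' ny' dy'] := outside_edge xO' yO' xy'.
have [xV xS] := setDP xO; have [yV yS] := setDP yO.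
have [xV' xS'] := setDP xO'; have [yV' yS'] := setDP yO'.
have y'x : y' != x.
  apply: contraTneq xy' => E; apply/negP => xx'.
  have : x' \in neighbours g V x by rewrite inE xV' -E gsym.
  by move/(subsetP nx); rewrite !inE (negbTE x'y) (negbTE xS').
have y'y : y' != y.
  apply: contraTneq xy' => E; apply/negP => xx'.
  have : x' \in neighbours g V y by rewrite inE xV' -E gsym.
  by move/(subsetP ny); rewrite !inE (negbTE x'x) (negbTE xS').
have [a [aS ax _]] := outside_S x nx dx.
have [b [bS bx' ba]] := outside_S a nx' dx'.
have ab : a != b by rewrite eq_sym.
have mk u v c : c \in S -> g c u -> g u v -> u \in V -> v \in V -> u \notin S -> v \notin S ->
    gpath g V c [:: u; v].
  move=> cS cu uv uV vV uS vS.
  rewrite !gpath_cons gpath_nil (subsetP SV _ cS) cu uv uV vV !inE negb_or !andbT /=.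
  apply/andP; split; last by apply: contraTneq uv => ->; rewrite girr.
  by apply/andP; split; [apply: contraNneq uS => <- | apply: contraNneq vS => <-].
have := outside_two aS bS ab (mk x y a aS ax xy xV yV xS yS) (mk x' y' b bS bx' xy' xV' yV' xS' yS').
move=> /(_ isT isT) H; suff : 2 + 2 + 2 * m.-1 < k by rewrite kE; move: rm; clear; lia.
apply: H => z; rewrite !inE.
  by case/or4P => /eqP->.
case/orP => /eqP->; rewrite negb_or; first by rewrite eq_sym x'x eq_sym y'x.
by rewrite eq_sym x'y eq_sym y'y.
Qed.

End Outside.

(** * The weight bound for connected graphs *)

Section Bound.
Variables (T : finType) (g : rel T).
Hypothesis gsym : symmetric g.
Hypothesis girr : irreflexive g.
Variables (r m : nat) (ev : bool) (M : {set {set T}}).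
Hypothesis r3 : 2 < r.
Hypothesis rm : r + 6 <= m.
Hypothesis mixM : mixed r M.
Hypothesis cliqueM : forall (e : {set T}) x y, e \in M -> x \in e -> y \in e -> x != y -> g x y.
Implicit Types (V W U X S C e Y : {set T}) (F : {set {set T}}) (x y u v a b : T) (s : seq T).

Let D := 'C(m, r.-1).
Let k := 2 * m + 1 + ev.

Definition members V : {set {set T}} := [set e in M | e \subset V].

Definition fibre V S Y : {set {set T}} := [set e in members V | e :\: S == Y].

Lemma mixed_fibre V S Y : mixed r (fibre V S Y).
Proof. by apply: mixed_sub mixM; apply/subsetP => e; rewrite !inE => /andP[/andP[]]. Qed.

Lemma in_fibre V S Y e : e \in fibre V S Y -> [/\ e \in M, e \subset V & e :\: S = Y].
Proof. by rewrite !inE => /andP[/andP[eM eV] /eqP]. Qed.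

Lemma fibre_card V S Y e : e \in fibre V S Y -> #|e| != 2 -> e \in trace_sets r S Y.
Proof.
move=> he e2; have [eM _ eY] := in_fibre he.
by rewrite inE eY eqxx andbT; case/orP: (proj1 mixM _ eM) => // h; rewrite h in e2.
Qed.

(** A member pair inside [S] would lie in a member made of [c] and [r - 1] vertices of [S], against
    the antichain property. *)
Lemma fibre0 V S c : #|S| = m -> c \notin S -> trace_sets r S [set c] \subset M ->
  fibre V S set0 \subset trace_sets r S set0.
Proof.
move=> Sm cS cM; apply/subsetP => e he; apply: fibre_card (he) _.
have [eM _ /eqP] := in_fibre he; rewrite setD_eq0 => eS.
apply/negP => /eqP e2.
have [|f [ef fS cf]] := @subset_card_between _ e S r.-1 eS.
  by rewrite e2 Sm; move: r3 rm; clear; lia.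
have cf' : c \notin f by apply: contraNN cS; apply: (subsetP fS).
have fM : c |: f \in M.
  apply: (subsetP cM); rewrite inE cardsU1 cf' cf; apply/andP; split.
    by apply/eqP; move: r3; clear; lia.
  apply/eqP/setP => z; rewrite !inE; have [->|zc /=] := eqVneq z c.
    by rewrite cS.
  by case zf : (z \in f); rewrite ?andbF // (subsetP fS).
have := proj2 mixM e _ eM fM (subset_trans ef (subsetUr _ _)).
by move/(congr1 (fun A : {set T} => #|A|)); rewrite e2 cardsU1 cf' cf; move: r3; clear; lia.
Qed.

Lemma fibre1 V S v : #|S| = m -> v \notin S ->
  fibre V S [set v] \subset trace_sets r S [set v] \/ #|fibre V S [set v]| < #|trace_sets r S [set v]|.
Proof.
move=> Sm vS.
have [|a [b [ab hb hs]]] := link_bound r3 (mixed_fibre V S [set v]) vS.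
  by move=> e /in_fibre[].
have [bm|bm] := ltnP b m; last by left; apply: hs; move: ab bm; rewrite Sm; clear; lia.
right; rewrite card_trace_sets ?cards1 ?subn1 ?disjoints1 //; last by move: r3; clear; lia.
apply: leq_ltn_trans hb _; rewrite Sm.
by have := bin_gap_link r3 rm bm; move: ab; rewrite Sm; clear; lia.
Qed.

(** If the pair itself is a member, the antichain property leaves it alone in its fibre, and
    [1 < 'C(m, r - 2)]. Otherwise the fibre consists of [r]-sets. *)
Lemma fibre2 V S x y : #|S| = m -> x \notin S -> y \notin S -> x != y ->
  fibre V S [set x; y] \subset trace_sets r S [set x; y] \/
  #|fibre V S [set x; y]| < #|trace_sets r S [set x; y]|.
Proof.
move=> Sm xS yS xy; have sub e : e \in fibre V S [set x; y] -> [set x; y] \subset e.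
  by move=> /in_fibre[_ _ <-]; apply: subsetDl.
have [xyM|xyM] := boolP ([set x; y] \in M); last first.
  left; apply/subsetP => e he; apply: fibre_card (he) _; apply: contraNN xyM => e2.
  suff -> : [set x; y] = e by case: (in_fibre he).
  by apply/eqP; rewrite eqEcard sub // (eqP e2) cards2 xy.
right; apply: (@leq_ltn_trans 1).
  rewrite -(cards1 [set x; y]); apply: subset_leq_card; apply/subsetP => e he.
  rewrite inE; apply/eqP/esym; apply: (proj2 mixM) => //; last exact: sub.
  by case: (in_fibre he).
rewrite card_trace_sets ?cards2 ?xy ?Sm; last first.
- by move: r3; clear; lia.
- apply/pred0P => z /=; rewrite !inE; apply/negP => /andP[/orP[]/eqP->]; exact/negP.
have := leq_bin2l (r - 2) (_ : (r - 2).+1 <= m).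
have -> : (r - 2).+1 <= m by move: rm r3; clear; lia.
by rewrite binSn => /(_ isT) /=; move: r3; clear; lia.
Qed.

Lemma extremal_fibre V S x y Y : Y \in traces ev V S x y ->
  [set e in extremal r ev V S x y | e :\: S == Y] = trace_sets r S Y.
Proof.
move=> hY; apply/setP => e; rewrite in_set in_extremal -andbA [RHS]in_set.
by congr (_ && _); apply: andb_idl => /eqP->.
Qed.

(** Each fibre is either contained in the full trace family or strictly smaller than it. Summing
    this dichotomy gives the inequality and its equality case at once. *)
Lemma members_le_extremal V S x y c : #|S| = m -> x \in V :\: S -> y \in V :\: S -> x != y ->
    c \notin S -> trace_sets r S [set c] \subset M ->
    (forall e, e \in members V -> e :\: S \in traces ev V S x y) ->
  weight M V <= #|extremal r ev V S x y| /\
  (weight M V = #|extremal r ev V S x y| -> members V = extremal r ev V S x y).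
Proof.
move=> Sm /setDP[_ xS] /setDP[_ yS] xy cS cM hT.
have alt Y : Y \in traces ev V S x y ->
    fibre V S Y \subset trace_sets r S Y \/ #|fibre V S Y| < #|trace_sets r S Y|.
  rewrite in_setU1 => /orP[/eqP->|]; first by left; apply: fibre0 Sm cS cM.
  rewrite in_setU => /orP[/imsetP[v /setDP[_ vS] ->]|]; first exact: fibre1.
  by case: (ev); rewrite inE // => /eqP->; apply: fibre2.
have le Y : Y \in traces ev V S x y -> #|fibre V S Y| <= #|trace_sets r S Y|.
  by move/alt => [/subset_leq_card|/ltnW].
have Ew : weight M V = \sum_(Y in traces ev V S x y) #|fibre V S Y|.
  exact: card_traces_sum.
have Ee : #|extremal r ev V S x y| = \sum_(Y in traces ev V S x y) #|trace_sets r S Y|.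
  rewrite (@card_traces_sum _ _ ev V S x y); last by move=> e; rewrite in_extremal => /andP[].
  by apply: eq_bigr => Y /extremal_fibre ->.
rewrite Ew Ee; split; first by apply: leq_sum.
have [/existsP[Y /andP[YT Ylt]] | /existsPn all] :=
  boolP [exists Y, (Y \in traces ev V S x y) && (#|fibre V S Y| < #|trace_sets r S Y|)].
  rewrite (bigD1 Y) //= [in RHS](bigD1 Y) //= => E; exfalso.
  have : \sum_(i in traces ev V S x y | i != Y) #|fibre V S i| <=
         \sum_(i in traces ev V S x y | i != Y) #|trace_sets r S i|.
    by apply: leq_sum => Z /andP[/le].
  by move=> /(leq_add Ylt); rewrite addSn E ltnn.
move=> E; apply/eqP; rewrite eqEcard; apply/andP; split; last first.
  by rewrite -[#|members V|]/(weight M V) Ew E Ee.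
apply/subsetP => e he; rewrite in_extremal hT // andbT.
have [sub|lt] := alt _ (hT e he); last by have := all (e :\: S); rewrite hT ?lt.
have : e \in fibre V S (e :\: S) by rewrite inE he eqxx.
by move/(subsetP sub); rewrite inE => /andP[].
Qed.

Lemma irreducible_structure V : connected_in g V -> irreducible g r m M V -> nopath g V k ->
    attach_bound k (m + 4) < #|V| ->
  exists S x y, [/\ [/\ #|S| = m, S \subset V, x \in V :\: S, y \in V :\: S & x != y],
    weight M V <= #|extremal r ev V S x y| &
    weight M V = #|extremal r ev V S x y| -> members V = extremal r ev V S x y].
Proof.
move=> cV irrV np hV.
have [V0 _] := cV; have /set0Pn[u uV] := V0.
have [S [F [S0 SV cF aF]]] := many_attached gsym cV uV (fun s gs => np u s gs) hV.
have [||Sm [F' [FF' cF' lF]]] := attached_leaves gsym girr r3 rm mixM cliqueM cV irrV SV S0 aF _ np.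
- by move: cF; clear; lia.
- by rewrite /k; case: (ev); clear; lia.
have aF' C : C \in F' -> attached g V S C by move/(subsetP FF'); apply: aF.
have cF2 : m + 2 <= #|F'| by move: cF cF'; clear; lia.
have getc C : C \in F' -> exists c, [/\ C = [set c], c \in V :\: S & trace_sets r S [set c] \subset M].
  move=> CF; have /existsP[c /andP[/eqP EC cM]] := lF C CF; exists c; split=> //.
  by have [sC _ _ _] := aF' C CF; apply: (subsetP sC); rewrite EC inE.
have /card_gt0P[C1 C1F] : 0 < #|F'| by move: cF2 rm; clear; lia.
have /card_gt0P[C2 /setD1P[C21 C2F]] : 0 < #|F' :\ C1|.
  by have := cardsD1 C1 F'; rewrite C1F; move: cF2 rm; clear; lia.
have [c1 [E1 c1O c1M]] := getc _ C1F; have [c2 [E2 c2O _]] := getc _ C2F.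
have c12 : c1 != c2 by apply: contraNneq C21 => E; rewrite E2 E1 E.
(* Without an outside edge any two outside vertices may serve as [x] and [y], here two leaves; with
   one, its ends are taken, and its existence forces [ev]. *)
have [x [y [xO yO xy hxy]]] : exists x y, [/\ x \in V :\: S, y \in V :\: S, x != y &
    forall u v, u \in V :\: S -> v \in V :\: S -> g u v -> ev /\ u \in [set x; y]].
  have [/exists_inP[x xO /exists_inP[y yO xy]]|/exists_inPn no] :=
    boolP [exists x in V :\: S, [exists y in V :\: S, g x y]]; last first.
    exists c1, c2; split=> // u' v uO vO uv; have := no u' uO.
    by rewrite negb_exists => /forallP/(_ v); rewrite vO uv.
  exists x, y; split=> //; first by apply: contraTneq xy => ->; rewrite girr.
  move=> u' v uO vO uv; move: np; rewrite /k; case: (ev) => np; last first.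
    have kE : 2 * m + 1 + false = (2 * m).+1 by clear; lia.
    by have := odd_no_edge gsym girr r3 rm cV SV Sm aF' lF cF2 np kE xO yO; rewrite xy.
  split=> //; apply: (one_outside_edge gsym girr r3 rm mixM cliqueM cV irrV SV Sm aF' lF cF2 np _ xO yO xy uO vO uv).
  by clear; lia.
have hT e : e \in members V -> e :\: S \in traces ev V S x y.
  rewrite inE => /andP[eM eV]; rewrite in_setU1; apply/orP.
  have [->|/set0Pn[v ve]] := eqVneq (e :\: S) set0; [by left|right].
  have eO z : z \in e :\: S -> z \in V :\: S by apply: subsetP; apply: setSD.
  rewrite in_setU; apply/orP; have [E|] := eqVneq (e :\: S) [set v].
    by left; apply/imsetP; exists v; [apply: eO | ].
  rewrite eqEsubset sub1set ve andbT => /subsetPn[u' ue]; rewrite inE => uv.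
  have adj a b : a \in e :\: S -> b \in e :\: S -> a != b -> g a b.
    by move=> /setDP[ae _] /setDP[be _]; apply: cliqueM eM ae be.
  have inxy z : z \in e :\: S -> ev /\ z \in [set x; y].
    move=> ze; have [E|zv] := eqVneq z v.
      by subst z; apply: (hxy v u' (eO _ ze) (eO _ ue)); apply: adj; rewrite // eq_sym.
    by apply: (hxy z v (eO _ ze) (eO _ ve)); apply: adj.
  right; have [-> _] := inxy v ve; rewrite inE eqEcard; apply/andP; split.
    by apply/subsetP => z /inxy[].
  rewrite cards2 xy; apply: leq_trans (_ : #|[set u'; v]| <= _); first by rewrite cards2 uv.
  by apply: subset_leq_card; rewrite subUset !sub1set ue.
have c1S : c1 \notin S by case/setDP: c1O.
by have [h1 h2] := members_le_extremal Sm xO yO xy c1S c1M hT; exists S, x, y; split.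
Qed.

(** The amount, independent of [n], by which the bound falls short of [D * n]. Adding it on the
    other side keeps all later inequalities free of truncated subtraction. *)
Definition deficit := m * D - ('C(m, r) + ev * 'C(m, r - 2)).

Lemma deficit_gt0 : 0 < deficit.
Proof.
have := @bin_neighbours_lt (r - 2) m.
have -> : (r - 2).+2 = r by move: r3; clear; lia.
have -> : (r - 2).+1 = r.-1 by move: r3; clear; lia.
rewrite -/D /deficit => H.
have : 'C(m, r) + 'C(m, r - 2) < m * D by apply: H; move: r3 rm; clear; lia.
by case: (ev) => /=; rewrite ?mul1n ?mul0n; clear; lia.
Qed.

Lemma extremal_deficit n : m <= n ->
  'C(m, r - 1) * (n - m) + 'C(m, r) + ev * 'C(m, r - 2) + deficit = D * n.
Proof.
move=> mn; have := deficit_gt0; rewrite /deficit -/D subn1 -/D => h.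
have -> : D * n = D * (n - m) + m * D by rewrite (mulnC m) -mulnDr subnK.
by move: h; clear; move: (D * (n - m)) (m * D); lia.
Qed.

(** Each step removes at most two vertices and raises the surplus, weight minus [D] per vertex, by
    at least one. So twice the gain is at least the number of removed vertices, which is the stated
    inequality in additive form. *)
Lemma peel_to_irreducible V : connected_in g V -> exists V', [/\ V' \subset V, connected_in g V', irreducible g r m M V' &
  2 * weight M V + 2 * (D * #|V'|) + #|V| <= 2 * weight M V' + 2 * (D * #|V|) + #|V'|].
Proof.
move En: #|V| => n; elim/ltn_ind: n V En => n IH V En cV.
have [irr|nirr] := Classical_Prop.classic (irreducible g r m M V).
  by exists V; split=> //; rewrite En.
have [X [XV X0 X2 cX lt]] : exists X, [/\ X \subset V, X != set0, #|X| <= 2,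
    connected_in g (V :\: X) & weight M V < weight M (V :\: X) + D * #|X|].
  apply: Classical_Prop.NNPP => no; apply: nirr => X XV X0 X2 cX; rewrite leqNgt; apply/negP => lt.
  by apply: no; exists X.
have cXV : #|V :\: X| + #|X| = n.
  by have := cardsID X V; rewrite (setIidPr XV) En; clear; lia.
have X1 : 0 < #|X| by rewrite card_gt0.
have [|V' [s1 c1 i1 h1]] := IH #|V :\: X| _ (V :\: X) erefl cX.
  by move: cXV X1; clear; lia.
exists V'; split=> //; first by apply: subset_trans s1 (subsetDl _ _).
by rewrite -cXV !mulnDr; move: h1 lt X2; clear; lia.
Qed.

(** If the irreducible part had at most [N] vertices, its weight would be at most
    [(k + 'C(k, r.-1)) * N], and by [peel_to_irreducible] a set [V] of weight at least
    [D * #|V| - deficit] would have at most this many vertices. The maximum with [m] is there for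
    [extremal_deficit]. *)
Definition size_bound :=
  let N := maxn (attach_bound k (m + 4)) m in
  2 * ((k + 'C(k, r.-1)) * N) + N + 2 * deficit.

Lemma connected_bound V : connected_in g V -> nopath g V k -> size_bound < #|V| ->
  weight M V + deficit <= D * #|V| /\
  (weight M V + deficit = D * #|V| ->
    exists S x y, [/\ #|S| = m, S \subset V, x \in V :\: S, y \in V :\: S & x != y] /\
      members V = extremal r ev V S x y).
Proof.
rewrite /size_bound; set L := k + _; set N2 := maxn _ m => cV np hV.
have [lt|ge] := ltnP (weight M V + deficit) (D * #|V|).
  by split; [apply: ltnW | move=> E; rewrite E ltnn in lt].
have [V' [V'V cV' irrV' hp]] := peel_to_irreducible cV.
have np' := nopath_sub V'V np.
have hL : degree_weight r k L.
  move=> a b ab; apply: leq_add; first by move: ab; clear; lia.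
  by apply: leq_bin2l; move: ab; clear; lia.
have wV' : weight M V' <= L * #|V'|.
  have [V0 _] := cV'; have /set0Pn[u uV'] := V0.
  apply: leq_trans (rooted_peel gsym r3 mixM girr cliqueM hL cV' uV' _) _.
    by move=> s gs; apply: ltnW; apply: np' gs.
  by rewrite leq_mul2l leq_pred orbT.
have big : N2 < #|V'|.
  rewrite ltnNge; apply/negP => small.
  have : L * #|V'| <= L * N2 by rewrite leq_mul2l small orbT.
  by move: hp ge hV wV' small; clear; lia.
have [|S [x [y [[Sm SV' xO yO xy] hle heq]]]] := irreducible_structure cV' irrV' np'.
  by apply: leq_ltn_trans big; apply: leq_maxl.
have mV' : m <= #|V'| by apply: leq_trans (ltnW big); apply: leq_maxr.
have Ee : #|extremal r ev V' S x y| + deficit = D * #|V'|.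
  by rewrite card_extremal // Sm extremal_deficit.
have EV : V' = V.
  by apply/eqP; rewrite eqEcard V'V; move: hp hle Ee ge; clear; lia.
rewrite {}EV in SV' xO yO hle heq Ee *.
split; first by move: hle Ee; clear; lia.
move=> E; exists S, x, y; split; first by split.
by apply: heq; move: E Ee; clear; lia.
Qed.

End Bound.

(** * Hall's theorem and the red-blue matching *)

Section Hall.
Variables (X Y : finType) (y0 : Y).
Implicit Types (A B : {set X}) (adj : X -> {set Y}).

(** Halmos-Vaughan induction. A tight proper subset [B] is matched by itself and the rest into what
    [B] leaves, where tightness preserves the condition. Without such a [B], one vertex takes any
    neighbour, as every remaining nonempty set has one to spare. The value [y0] serves the empty
    case. *)
Lemma Hall_marriage A adj :
    (forall B, B \subset A -> #|B| <= #|\bigcup_(x in B) adj x|) ->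
  exists f : X -> Y, {in A &, injective f} /\ {in A, forall x, f x \in adj x}.
Proof.
move En: #|A| => n; elim/ltn_ind: n A adj En => n IH A adj En hall.
have [A0|/set0Pn[a aA]] := eqVneq A set0.
  by exists (fun=> y0); rewrite A0; split=> x; rewrite inE.
have [/existsP[B /and4P[BA B0 Bne Btight]]|/existsPn no] :=
  boolP [exists B : {set X}, [&& B \subset A, B != set0, B != A &
                               #|\bigcup_(x in B) adj x| <= #|B|]].
  pose NB := \bigcup_(x in B) adj x.
  have ltB : #|B| < n by rewrite -En; apply: proper_card; rewrite properEneq Bne.
  have [|f1 [inj1 adj1]] := IH _ ltB B adj erefl.
    by move=> B' B'B; apply: hall; apply: subset_trans BA.
  have cD : #|A :\: B| + #|B| = n.
    by have := cardsID B A; rewrite (setIidPr BA) En; clear; lia.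
  have ltD : #|A :\: B| < n by move: B0 cD; rewrite -card_gt0; clear; lia.
  have [|f2 [inj2 adj2]] := IH _ ltD (A :\: B) (fun x => adj x :\: NB) erefl.
    move=> B' B'D; have dis : B' :&: B = set0.
      apply/setP => x; rewrite !inE; apply/negP => /andP[/(subsetP B'D)].
      by rewrite inE => /andP[/negP].
    have := hall (B' :|: B); rewrite subUset BA andbT cardsU dis cards0 subn0.
    move/(_ (subset_trans B'D (subsetDl _ _))); rewrite bigcup_setU.
    have -> : \bigcup_(x in B') (adj x :\: NB) = (\bigcup_(x in B') adj x) :\: NB.
      apply/setP => y; rewrite !inE; apply/bigcupP/andP => [[x xB]|[yN /bigcupP[x xB yx]]].
        by rewrite !inE => /andP[yN yx]; split=> //; apply/bigcupP; exists x.
      by exists x; rewrite // inE yN.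
    rewrite -/NB; have := cardsID NB ((\bigcup_(x in B') adj x) :|: NB).
    rewrite setDUl setDv setU0 (setIidPr (subsetUr _ _)).
    by move: Btight; rewrite -/NB; clear; lia.
  exists (fun x => if x \in B then f1 x else f2 x); split; last first.
    move=> x xA; case: ifPn => xB; first exact: adj1.
    by have := adj2 x; rewrite !inE xB => /(_ xA)/andP[].
  have cross x y : x \in A -> y \in B -> x \notin B -> f2 x != f1 y.
    move=> xA yB xB; apply: contraTneq (adj1 y yB) => <-.
    have := adj2 x; rewrite !inE xB => /(_ xA)/andP[+ _].
    by apply: contraNN => h; apply/bigcupP; exists y.
  move=> x y xA yA; case: ifPn => xB; case: ifPn => yB.
  - exact: inj1.
  - by move=> E; have := cross y x yA xB yB; rewrite E eqxx.
  - by move=> E; have := cross x y xA yB xB; rewrite E eqxx.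
  - by apply: inj2; rewrite inE ?xB ?yB.
have /card_gt0P[y ya] : 0 < #|adj a|.
  by have := hall [set a]; rewrite sub1set cards1 big_set1; apply.
have cA : #|A :\ a|.+1 = n by rewrite -En (cardsD1 a A) aA.
have ltA : #|A :\ a| < n by rewrite -cA.
have [|f [injf adjf]] := IH _ ltA (A :\ a) (fun x => adj x :\ y) erefl.
  move=> B BA; have [->|B0] := eqVneq B set0; first by rewrite cards0.
  have := no B; rewrite B0 (subset_trans BA (subD1set _ _)) /=.
  have -> : B != A by apply: contraTneq BA => ->; rewrite subsetD1 aA andbF.
  rewrite /= -ltnNge => lt.
  have -> : \bigcup_(x in B) (adj x :\ y) = (\bigcup_(x in B) adj x) :\ y.
    apply/setP => z; rewrite !inE; apply/bigcupP/andP => [[x xB]|[zN /bigcupP[x xB zx]]].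
      by rewrite !inE => /andP[zN zx]; split=> //; apply/bigcupP; exists x.
    by exists x; rewrite // !inE zN.
  move: lt; rewrite (cardsD1 y (\bigcup_(x in B) adj x)).
  by case: (y \in _) => /=; clear; lia.
exists (fun x => if x == a then y else f x); split; last first.
  move=> x xA; case: eqP => [-> //|/eqP xa].
  by have := adjf x; rewrite !inE xa => /(_ xA)/andP[].
have ny x : x \in A -> x != a -> f x != y.
  by move=> xA xa; have := adjf x; rewrite !inE xa => /(_ xA)/andP[].
move=> x z xA zA; case: eqP => [->|/eqP xa]; case: eqP => [-> //|/eqP za].
- by move=> E; have := ny z zA za; rewrite E eqxx.
- by move=> E; have := ny x xA xa; rewrite E eqxx.
- by apply: injf; rewrite !inE ?xa ?za.
Qed.

End Hall.

Section RedBlue.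
Variables (T : finType).
Implicit Types (B H : {set {set T}}) (e p : {set T}).

Definition pairs_of B : {set {set T}} := [set p : {set T} | (#|p| == 2) && [exists e in B, p \subset e]].

Lemma in_pairs_of B p : p \in pairs_of B -> #|p| = 2 /\ exists2 e, e \in B & p \subset e.
Proof. by rewrite inE => /andP[/eqP-> /exists_inP]. Qed.

Lemma pairs_ofP B p e : #|p| = 2 -> e \in B -> p \subset e -> p \in pairs_of B.
Proof. by move=> p2 eB pe; rewrite inE p2 eqxx; apply/exists_inP; exists e. Qed.

(* [B] maximizes [#|B| - #|pairs_of B|]; maximality gives Hall's condition both for
   matching [H :\: B] into pairs outside [pairs_of B] and for matching [pairs_of B] into [B]. *)
Lemma red_blue H : exists B (f psi : {set T} -> {set T}),
  [/\ B \subset H,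
      {in H :\: B &, injective f},
      {in H :\: B, forall e, [/\ #|f e| = 2, f e \subset e & f e \notin pairs_of B]},
      {in pairs_of B &, injective psi} &
      {in pairs_of B, forall p, psi p \in B /\ p \subset psi p}].
Proof.
(* The number of all sets is added so that the difference [#|B| - #|pairs_of B|] is not
   truncated. *)
pose val B := #|B| + #|{: {set T}}| - #|pairs_of B|.
have val_eq B : val B + #|pairs_of B| = #|B| + #|{: {set T}}|.
  by rewrite /val subnK // (leq_trans (max_card _)) // leq_addl.
have [B BH max] := @arg_maxnP _ set0 (fun B => B \subset H) val (sub0set H).
have [f [injf adjf]] : exists f : {set T} -> {set T}, {in H :\: B &, injective f} /\
    {in H :\: B, forall e, f e \in [set p : {set T} | [&& #|p| == 2, p \subset e & p \notin pairs_of B]]}.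
  apply: (Hall_marriage set0) => X XHB.
  set N := \bigcup_(x in X) _.
  have dXB : X :&: B = set0.
    apply/setP => e; rewrite !inE; apply/negP => /andP[/(subsetP XHB)].
    by rewrite inE => /andP[/negP].
  have h1 : val (B :|: X) <= val B.
    by apply: max; rewrite subUset BH (subset_trans XHB (subsetDl _ _)).
  have h2 : #|pairs_of (B :|: X)| <= #|pairs_of B| + #|N|.
    apply: leq_trans (leq_card_setU _ _); apply: subset_leq_card; apply/subsetP => p.
    move=> /in_pairs_of[p2 [e +  pe]]; rewrite !inE => /orP[eB|eX].
      by rewrite p2 eqxx /=; apply/orP; left; apply/exists_inP; exists e.
    rewrite p2 eqxx /=; have [//|pB] := boolP [exists e in B, p \subset e]; apply/orP; right.
    by apply/bigcupP; exists e; rewrite // !inE p2 eqxx pe.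
  have h3 : #|B :|: X| = #|B| + #|X| by rewrite cardsU setIC dXB cards0 subn0.
  move: h1 h2 h3 (val_eq B) (val_eq (B :|: X)); clear.
  by move: (val B) (val _) #|pairs_of (_ :|: _)| #|pairs_of B| #|_ :|: _|; lia.
have [psi [injpsi adjpsi]] : exists f : {set T} -> {set T}, {in pairs_of B &, injective f} /\
    {in pairs_of B, forall p, f p \in [set e in B | p \subset e]}.
  apply: (Hall_marriage set0) => X XB.
  set N := \bigcup_(x in X) _.
  have NB : N \subset B by apply/bigcupsP => p _; apply/subsetP => e; rewrite inE => /andP[].
  have h1 : val (B :\: N) <= val B by apply: max; apply: subset_trans (subsetDl _ _) BH.
  have h2 : #|pairs_of (B :\: N)| + #|X| <= #|pairs_of B|.
    have dis : pairs_of (B :\: N) :&: X = set0.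
      apply/setP => p; rewrite !in_set0 in_setI; apply/negP => /andP[/in_pairs_of[p2 [e]]].
      rewrite in_setD => /andP[eN eB] pe pX; case/negP: eN.
      by apply/bigcupP; exists p; rewrite // inE eB.
    rewrite -[_ + _]subn0 -(cards0 {set T}) -dis -cardsU; apply: subset_leq_card.
    rewrite subUset XB andbT; apply/subsetP => p /in_pairs_of[p2 [e]].
    by rewrite in_setD => /andP[_ eB] pe; apply: (pairs_ofP p2 eB pe).
  have h3 := cardsID N B; rewrite (setIidPr NB) in h3.
  move: h1 h2 h3 (val_eq B) (val_eq (B :\: N)); clear.
  by move: (val B) (val _) #|pairs_of (_ :\: _)| #|pairs_of B| #|_ :\: _| #|{: {set T}}|; move: #|N| #|B| #|X|; lia.
exists B, f, psi; split=> //.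
  by move=> e /adjf; rewrite inE => /and3P[/eqP].
by move=> p /adjpsi; rewrite inE => /andP[].
Qed.

End RedBlue.

(** * Berge paths from graph paths *)

Section BergeLists.
Variables (T : finType) (H : {set {set T}}).
Implicit Types (x y z u v : T) (s : seq T) (e h p U W : {set T}) (es : seq {set T}).

(** A Berge walk; the distinctness of vertices and of hyperedges is kept apart as two [uniq]
    conditions, which makes concatenation and reversal easy. *)
Fixpoint bpath x s es : bool :=
  match s, es with
  | [::], [::] => true
  | y :: s', e :: es' => [&& e \in H, x \in e, y \in e & bpath y s' es']
  | _, _ => false
  end.

Lemma bpath_size x s es : bpath x s es -> size es = size s.
Proof. by elim: s x es => [|y s IH] x [|e es] //= /and4P[_ _ _ /IH->]. Qed.

Lemma bpath_cat x s1 s2 es1 es2 : bpath x s1 es1 -> bpath (last x s1) s2 es2 ->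
  bpath x (s1 ++ s2) (es1 ++ es2).
Proof.
elim: s1 x es1 => [|y s1 IH] x [|e es1] //= /and4P[-> -> -> h1] h2 /=.
exact: IH.
Qed.

Lemma bpath_rev x s es : bpath x s es -> bpath (last x s) (rev (belast x s)) (rev es).
Proof.
elim: s x es => [|y s IH] x [|e es] //= /and4P[eH xe ye /IH h].
rewrite !rev_cons -!cats1; apply: bpath_cat => //=.
have -> : last (last y s) (rev (belast y s)) = y.
  by case: s {IH h} => //= z s; rewrite rev_cons last_rcons.
by rewrite eH ye xe.
Qed.

Lemma bpath_mem x s es e : bpath x s es -> e \in es -> e \in H.
Proof.
elim: s x es => [|y s IH] x [|e' es] //= /and4P[eH _ _ h].
by rewrite inE => /orP[/eqP->//|/(IH _ _ h)].
Qed.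

Lemma bpath_nth x s es i : bpath x s es -> i < size s ->
  [/\ nth set0 es i \in H, nth x (x :: s) i \in nth set0 es i &
      nth x (x :: s) i.+1 \in nth set0 es i].
Proof.
suff G x0 : bpath x s es -> i < size s -> [/\ nth set0 es i \in H,
    nth x0 (x :: s) i \in nth set0 es i & nth x0 (x :: s) i.+1 \in nth set0 es i].
  exact: G.
elim: s x es i => [|y s IH] x [|e es] [|i] //= /and4P[eH xe ye h]; first by split.
rewrite ltnS; exact: IH.
Qed.

End BergeLists.

Lemma bpath_has_berge_path n (H : {set {set 'I_n}}) x s es k : bpath H x s es ->
  uniq (x :: s) -> uniq es -> k <= size s -> has_berge_path H k.
Proof.
move=> hb us ues ks.
exists (fun i : 'I_k.+1 => nth x (x :: s) i), (fun i : 'I_k => nth set0 es i); split; [|split].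
- move=> i j /eqP; rewrite nth_uniq //= ?ltnS.
  + by move/eqP/val_inj.
  + by apply: leq_trans ks; rewrite -ltnS.
  + by apply: leq_trans ks; rewrite -ltnS.
- move=> i j /eqP; rewrite nth_uniq //= ?(bpath_size hb).
  + by move/eqP/val_inj.
  + by apply: leq_trans ks.
  + by apply: leq_trans ks.
by move=> i; have := bpath_nth hb (leq_trans (ltn_ord i) ks); rewrite /= /bump.
Qed.

Section Realize.
Variables (T : finType) (H P : {set {set T}}) (psi : {set T} -> {set T}).
Hypothesis psi_inj : {in P &, injective psi}.
Hypothesis psiP : {in P, forall p, psi p \in H /\ p \subset psi p}.
Implicit Types (x y z u v : T) (s : seq T) (e h p U W : {set T}) (es : seq {set T}).

Definition pair_graph : rel T := fun x y => (x != y) && ([set x; y] \in P).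

Lemma pair_graph_sym : symmetric pair_graph.
Proof. by move=> x y; rewrite /pair_graph eq_sym setUC. Qed.

Lemma pair_graph_irr : irreflexive pair_graph.
Proof. by move=> x; rewrite /pair_graph eqxx. Qed.

Fixpoint edges_of x s : seq {set T} :=
  if s is y :: s' then psi [set x; y] :: edges_of y s' else [::].

Lemma edges_ofP V x s e : gpath pair_graph V x s -> e \in edges_of x s ->
  exists u v, [/\ u \in x :: s, v \in x :: s, pair_graph u v & e = psi [set u; v]].
Proof.
elim: s x => [|y s IH] x //; rewrite gpath_cons => /and4P[_ xy _ gs].
rewrite /= inE => /orP[/eqP->|/(IH _ gs)[u [v [us vs uv ->]]]].
  by exists x, y; rewrite !inE !eqxx !orbT.
by exists u, v; split; rewrite // inE ?us ?vs orbT.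
Qed.

Lemma bpath_edges_of V x s : gpath pair_graph V x s -> bpath H x s (edges_of x s).
Proof.
elim: s x => [|y s IH] x //; rewrite gpath_cons => /and4P[_ /andP[_ xy] _ /IH gs] /=.
have [h1 /subsetP h2] := psiP xy.
by rewrite h1 gs !h2 // !inE eqxx ?orbT.
Qed.

Lemma uniq_edges_of V x s : gpath pair_graph V x s -> uniq (edges_of x s).
Proof.
elim: s x => [|y s IH] x //; rewrite gpath_cons => /and4P[_ /andP[xNy xy] xs gs] /=.
rewrite IH // andbT; apply/negP => /(edges_ofP gs)[u [v [us vs /andP[_ uv]]]].
move/(psi_inj xy uv) => /setP/(_ x); rewrite !inE eqxx /=.
case/esym/orP => /eqP E; first by rewrite E us in xs.
by rewrite E vs in xs.
Qed.

End Realize.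

Section Link.
Variables (T : finType) (H : {set {set T}}).
Implicit Types (x y z u v w : T) (s : seq T) (e h p U W : {set T}) (es : seq {set T}).

Hypothesis Hconn : forall U, U != set0 -> U != setT ->
  exists h, [/\ h \in H, ~~ [disjoint h & U] & ~~ (h \subset U)].

(** The end vertices [z] and [w] are left free because they are chosen later, as starts of long
    paths inside [U] and [W]. That the outer hyperedges leave [U] and [W] will force them to be red
    when these are components. *)
Definition linking U W s es :=
  [/\ [/\ uniq s, uniq es, es != [::] & {in s, forall y, (y \notin U) && (y \notin W)}],
      {in es, forall e, e != head set0 es -> [disjoint e & U]},
      {in es, forall e, e != last set0 es -> [disjoint e & W]},
      [/\ ~~ [disjoint head set0 es & U], ~~ (head set0 es \subset U),
          ~~ [disjoint last set0 es & W] & ~~ (last set0 es \subset W)] &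
      forall z w, z \in head set0 es -> w \in last set0 es -> bpath H z (rcons s w) es].

(* Enlarge [U] by all hyperedges meeting it until a hyperedge meets both sides. *)
Lemma ex_linking U W : U != set0 -> W != set0 -> [disjoint U & W] ->
  exists s es, linking U W s es.
Proof.
move En: #|~: U| => N; elim/ltn_ind: N U En => N IH U En U0 W0 dUW.
have UT : U != setT.
  apply: contraNneq W0 => E; rewrite -subset0 -(setCT T) -E.
  by rewrite -disjoints_subset disjoint_sym.
have [/existsP[h /and3P[hH hU hW]]|/existsPn no] :=
  boolP [exists h : {set T}, [&& h \in H, ~~ [disjoint h & U] & ~~ [disjoint h & W]]].
  have nsub (A B : {set T}) : [disjoint A & B] -> ~~ [disjoint h & B] -> ~~ (h \subset A).
    by move=> dAB; apply: contraNN => hA; apply: disjointWl hA dAB.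
  exists [::], [:: h]; split=> //=.
  - by move=> e; rewrite inE => /eqP->; rewrite eqxx.
  - by move=> e; rewrite inE => /eqP->; rewrite eqxx.
  - by split=> //; [apply: nsub dUW hW | apply: nsub hU; rewrite disjoint_sym].
  by move=> z w zh wh; rewrite hH zh wh.
pose U1 := U :|: \bigcup_(h in H | ~~ [disjoint h & U]) h.
have UU1 : U \subset U1 by apply: subsetUl.
have hU1 h : h \in H -> ~~ [disjoint h & U] -> h \subset U1.
  by move=> hH hU; apply: subset_trans (subsetUr _ _); apply: bigcup_sup; rewrite hH.
have dW h : h \in H -> ~~ [disjoint h & U] -> [disjoint h & W].
  by move=> hH hU; have := no h; rewrite hH hU negbK.
have dU1W : [disjoint U1 & W].
  apply/pred0P => y /=; apply/negP => /andP[+ yW]; rewrite inE => /orP[yU|/bigcupP[h /andP[hH hU] yh]].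
    by rewrite (disjointFr dUW yU) in yW.
  by rewrite (disjointFr (dW h hH hU) yh) in yW.
have U10 : U1 != set0 by apply: contraNneq U0 => E; rewrite -subset0 -E.
have lt : #|~: U1| < N.
  have [h [hH hU /subsetPn[y yh yU]]] := Hconn U0 UT.
  rewrite -En; apply: proper_card; apply/properP; split; first by rewrite setCS.
  by exists y; rewrite !inE ?yU //= negbK; apply/orP; right; apply/bigcupP; exists h; rewrite // hH.
have [s [es [[us ues es0 sout] dU dWe [hU hUs lW lWs] bp]]] := IH _ lt U1 erefl U10 W0 dU1W.
have mem_head : head set0 es \in es by case: (es) es0 => // e es' _; rewrite mem_head.
have esH e : e \in es -> e \in H.
  move/pred0Pn: hU => [z /andP[zh _]]; move/pred0Pn: lW => [w /andP[wl _]].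
  by move=> ee; apply: (bpath_mem (bp z w zh wl)).
have esU e : e \in es -> [disjoint e & U].
  move=> ee; have [E|ne] := eqVneq e (head set0 es).
    apply: contraT => eU; case/negP: hUs; rewrite -E; exact: hU1 (esH _ ee) eU.
  by apply: disjointWr UU1 (dU e ee ne).
move/pred0Pn: hU => [z1 /andP[/= z1h z1U1]].
have z1U : z1 \notin U by rewrite (disjointFr (esU _ mem_head) z1h).
have [h [hH hU z1h1]] : exists h, [/\ h \in H, ~~ [disjoint h & U] & z1 \in h].
  move: z1U1; rewrite inE (negbTE z1U) => /bigcupP[h /andP[hH hU] zh].
  by exists h.
have hes : h \notin es by apply: contraNN hU => /esU.
have hl : h != last set0 es.
  apply: contraNneq hes => ->; case: (es) es0 => // e es' _; exact: (mem_last e es').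
have lE : last h es = last set0 es by case: (es) es0.
exists (z1 :: s), (h :: es); split.
- split=> //.
  + rewrite /= us andbT; apply/negP => /sout; by rewrite z1U1.
  + by rewrite /= hes.
  + move=> y; rewrite inE => /orP[/eqP->|/sout/andP[yU yW]].
      by rewrite z1U (disjointFr dU1W z1U1).
    by rewrite yW andbT; apply: contraNN yU; apply: (subsetP UU1).
- by move=> e /=; rewrite inE => /orP[/eqP->|ee _]; [rewrite eqxx | apply: esU].
- move=> e /=; rewrite lE inE => /orP[/eqP-> _|]; [exact: dW | exact: dWe].
- by rewrite /= lE; split=> //; apply/subsetPn; exists z1.
by move=> z w /= zh; rewrite lE => wl; rewrite hH zh z1h1 bp.
Qed.

End Link.

(** * Long Berge paths across two components *)

Section Cross.
Variables (T : finType) (r : nat) (H B : {set {set T}}) (f psi : {set T} -> {set T}).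
Hypothesis r3 : 2 < r.
Hypothesis Hr : forall e, e \in H -> #|e| = r.
Hypothesis BH : B \subset H.
Hypothesis f_inj : {in H :\: B &, injective f}.
Hypothesis fP : {in H :\: B, forall e, [/\ #|f e| = 2, f e \subset e & f e \notin pairs_of B]}.
Hypothesis psi_inj : {in pairs_of B &, injective psi}.
Hypothesis psiP : {in pairs_of B, forall p, psi p \in B /\ p \subset psi p}.
Implicit Types (x y z u v w : T) (s : seq T) (e h p U V W : {set T}) (es : seq {set T}).

Definition red : {set {set T}} := f @: (H :\: B).
Definition mixed_family := red :|: B.
Definition matched := red :|: pairs_of B.
(** The hyperedge owned by a graph edge: matched by [psi] for a blue pair, the preimage under [f]
    for a red one. The default [set0] is not reached on [matched]. *)
Definition host p : {set T} :=
  if p \in pairs_of B then psi p else odflt set0 [pick e in H :\: B | f e == p].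

Let M := mixed_family.
Let g := pair_graph matched.

Lemma host_red h : h \in H :\: B -> host (f h) = h.
Proof.
move=> hh; have [_ _ fh] := fP hh; rewrite /host (negbTE fh).
case: pickP => [e /andP[eH /eqP E]|/(_ h)] /=; first exact: f_inj.
by rewrite hh eqxx.
Qed.

Lemma host_inj : {in matched &, injective host}.
Proof.
move=> p q; rewrite !in_setU => /orP[/imsetP[h hh ->]|pB] /orP[/imsetP[h' hh' ->]|qB].
- by rewrite !host_red // => ->.
- rewrite host_red // /host qB => E; have [qB' _] := psiP qB.
  by move: hh; rewrite inE E qB'.
- rewrite host_red // /host pB => E; have [pB' _] := psiP pB.
  by move: hh'; rewrite inE -E pB'.
by rewrite /host pB qB; apply: psi_inj.
Qed.

Lemma hostP : {in matched, forall p, host p \in H /\ p \subset host p}.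
Proof.
move=> p; rewrite in_setU => /orP[/imsetP[h hh ->]|pB].
  by rewrite host_red //; have [_ -> _] := fP hh; case/setDP: hh.
by rewrite /host pB; have [h1 h2] := psiP pB; split=> //; apply: (subsetP BH).
Qed.

Lemma matched_host h p : h \in H :\: B -> p \in matched -> host p = h -> p = f h.
Proof.
move=> hh pM E; apply: host_inj => //; last by rewrite host_red.
by rewrite in_setU; apply/orP; left; apply/imsetP; exists h.
Qed.

Lemma red_blue_disjoint : red :&: B = set0.
Proof.
apply/setP => e; rewrite !inE; apply/negP => /andP[/imsetP[h hh ->] eB].
have [e2 _ _] := fP hh; have := Hr (subsetP BH _ eB).
by rewrite e2; move: r3; clear; lia.
Qed.

Lemma card_mixed_family : #|M| = #|H|.
Proof.
rewrite cardsU red_blue_disjoint cards0 subn0 card_in_imset //.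
by have := cardsID B H; rewrite (setIidPr BH) addnC.
Qed.

(** The only inclusion that sizes do not settle is a red pair inside a blue set, and it is excluded
    because [f] avoids [pairs_of B]. *)
Lemma mixed_mixed_family : mixed r M.
Proof.
have sz e : e \in M -> (e \in red /\ #|e| = 2) \/ (e \in B /\ #|e| = r).
  rewrite inE => /orP[eR|eB]; last by right; rewrite Hr // (subsetP BH).
  by left; split=> //; case/imsetP: eR => h hh ->; have [-> _ _] := fP hh.
split; first by move=> e /sz[] [_ ->]; rewrite eqxx ?orbT.
move=> e e' /sz[[eR e2]|[eB er]] /sz[[eR' e2']|[eB' er']] sub.
- by apply/eqP; rewrite eqEcard sub e2 e2'.
- case/imsetP: eR => h hh E; have [_ _ /negP[]] := fP hh.
  by rewrite -E; apply: pairs_ofP e2 eB' sub.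
- by move/subset_leq_card: sub; rewrite er e2'; move: r3; clear; lia.
by apply/eqP; rewrite eqEcard sub er er' leqnn.
Qed.

Lemma mixed_family_clique e x y : e \in M -> x \in e -> y \in e -> x != y -> g x y.
Proof.
move=> eM xe ye xy; rewrite /g /pair_graph xy /= in_setU.
have sub : [set x; y] \subset e by rewrite subUset !sub1set xe.
move: eM; rewrite inE => /orP[eR|eB]; apply/orP; [left|right]; last first.
  by apply: pairs_ofP eB sub; rewrite cards2 xy.
suff -> : [set x; y] = e by [].
apply/eqP; rewrite eqEcard sub cards2 xy.
by case/imsetP: eR => h hh ->; have [-> _ _] := fP hh.
Qed.

(** The contrapositive of [rooted_peel]. The graph and the family are parameters so that it applies
    also after one pair has been given up. *)
Lemma rooted_long (g' : rel T) M' V u (p : nat) L : symmetric g' -> irreflexive g' -> mixed r M' ->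
    (forall e x y, e \in M' -> x \in e -> y \in e -> x != y -> g' x y) ->
    degree_weight r p L -> connected_in g' V -> u \in V -> L * #|V|.-1 < weight M' V ->
  exists s, gpath g' V u s /\ p < size s.
Proof.
move=> sg ig mM cM hL cV uV lt.
have P0 : gpath g' V u [::] by rewrite gpath_nil.
have [s [gs max]] := longest_seq P0 (fun s gs => ltnW (gpath_size gs)).
exists s; split=> //; rewrite ltnNge; apply/negP => sp.
move: lt; rewrite ltnNge; apply/negP/negPn.
apply: (rooted_peel sg r3 mM ig cM hL cV uV) => t /max ts; exact: leq_trans ts sp.
Qed.

(* The link edge [h] is red; if its pair [f h] lies inside [U] that pair is given up, and the
   path starts from whichever of its ends lies in a dense enough component. *)
Lemma path_avoiding_link_edge U h (p : nat) L : connected_in g U -> (forall a b, a \in U -> g a b -> b \in U) ->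
    h \in H -> ~~ [disjoint h & U] -> ~~ (h \subset U) ->
    degree_weight r p L -> 1 < L -> L * #|U| <= weight M U ->
  exists z s, [/\ z \in h, gpath g U z s, p < size s & h \notin edges_of host z s].
Proof.
move=> cU clU hH hU hUs hL L1 dense.
have U0 : 0 < #|U| by rewrite card_gt0; case: cU.
(* A blue hyperedge is a clique of the graph and would stay inside the closed set [U]. *)
have hB : h \in H :\: B.
  rewrite inE hH andbT; apply/negP => hB.
  case/pred0Pn: hU => z /andP[/= zh zU]; case/subsetPn: hUs => y yh yU.
  have zy : z != y by apply: contraNneq yU => <-.
  case/negP: yU; apply: clU zU _; apply: mixed_family_clique zh yh zy.
  by rewrite inE hB orbT.
have [f2 fh fB] := fP hB.
have fM : f h \in M by rewrite inE; apply/orP; left; apply/imsetP; exists h.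
have gsym : symmetric g by apply: pair_graph_sym.
have girr : irreflexive g by apply: pair_graph_irr.
have [fU|fU] := boolP (f h \subset U); last first.
  case/pred0Pn: hU => z /andP[/= zh zU].
  have [|s [gs ps]] := rooted_long gsym girr mixed_mixed_family mixed_family_clique hL cU zU.
    apply: leq_trans dense; case: #|U| U0 => // c _; rewrite /= mulnS.
    by move: L1; clear; lia.
  exists z, s; split=> //; apply: contraNN fU => /(edges_ofP gs)[u [v [us vs /andP[_ uv] E]]].
  rewrite -(matched_host hB uv (esym E)) subUset !sub1set.
  by rewrite (gpath_in gs us) (gpath_in gs vs).
have /cards2P[x [y [xy Exy]]] : #|f h| == 2 by rewrite f2.
pose g' := [rel a b | g a b && ([set a; b] != f h)].
pose M' := M :\ f h.
have sg' : symmetric g' by move=> a b; rewrite /= gsym setUC.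
have ig' : irreflexive g' by move=> a; rewrite /= girr.
have mM' : mixed r M' by apply: mixed_sub mixed_mixed_family; apply: subD1set.
have cM' e a b : e \in M' -> a \in e -> b \in e -> a != b -> g' a b.
  move=> /setD1P[ef eM] ae be ab; rewrite /= (mixed_family_clique eM) //=.
  apply: contraNneq ef => E; apply/eqP/esym; apply: (proj2 mixed_mixed_family) => //.
  by rewrite -E subUset !sub1set ae.
have gg' V z s : gpath g' V z s -> gpath g V z s.
  case/and3P => aV ps us; rewrite /gpath aV us andbT /=.
  by apply: sub_path ps => a b /andP[].
have avoid V z s : gpath g' V z s -> h \notin edges_of host z s.
  move=> gs; apply/negP => hes.
  have : path g' z s by case/and3P: gs.
  have := gg' _ _ _ gs; elim: s z hes {gs} => [|b s IH] a //=.
  rewrite inE gpath_cons => /orP[/eqP E|hes] /and4P[_ /andP[_ ab] _ gs] /andP[/andP[_ ne] ps].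
    by rewrite (matched_host hB ab (esym E)) eqxx in ne.
  exact: IH hes gs ps.
have [xh yh] : x \in h /\ y \in h.
  by split; apply: (subsetP fh); rewrite Exy !inE eqxx ?orbT.
have [xU yU] : x \in U /\ y \in U.
  by split; apply: (subsetP fU); rewrite Exy !inE eqxx ?orbT.
have fin z : z \in h -> z \in U -> L * #|component g' U z|.-1 < weight M' (component g' U z) ->
    exists z s, [/\ z \in h, gpath g U z s, p < size s & h \notin edges_of host z s].
  move=> zh zU lt; have sub : component g' U z \subset U by apply: component_sub.
  have zC : z \in component g' U z by rewrite inE connect0.
  have [s [gs ps]] := rooted_long sg' ig' mM' cM' hL (component_conn sg' zU) zC lt.
  by exists z, s; split; rewrite ?(avoid _ _ _ gs) //; apply: gpath_sub sub _; apply: gg'.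
have wU : weight M U <= (weight M' U).+1.
  have fin' : f h \in [set e in M | e \subset U] by rewrite inE fM.
  rewrite /weight (cardsD1 (f h)) fin' add1n ltnS.
  by apply: subset_leq_card; apply/subsetP => e; rewrite !inE andbA.
pose Ux := component g' U x; pose Uy := component g' U y.
have UxU : Ux \subset U by apply: component_sub.
have UyU : Uy \subset U by apply: component_sub.
have cover : U \subset Ux :|: Uy.
  apply: (conn_closed_sub cU xU); first by rewrite !inE connect0.
  move=> a b aW aU bU ab; have [E|ne] := eqVneq [set a; b] (f h).
    have : b \in f h by rewrite -E !inE eqxx orbT.
    by rewrite Exy !inE => /orP[/eqP->|/eqP->]; rewrite connect0 ?orbT.
  have ab' : g' a b by rewrite /= ab.
  move: aW; rewrite inE => /orP[aX|aY]; rewrite inE; apply/orP; [left|right].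
    exact: component_closed aX aU bU ab'.
  exact: component_closed aY aU bU ab'.
have [ltx|gex] := ltnP (L * #|Ux|.-1) (weight M' Ux); first exact: fin xh xU ltx.
have [lty|gey] := ltnP (L * #|Uy|.-1) (weight M' Uy); first exact: fin yh yU lty.
(* Both ends fail. If they are still connected, [U] has weight at most [1 + L * (#|U| - 1)]; if [U]
   splits in two, at most [1 + L * (#|U| - 2)]. Both contradict the density of [U], since
   [L > 1]. *)
exfalso.
have [yX|yX] := boolP (y \in Ux).
  have EU : Ux = U.
    apply/eqP; rewrite eqEsubset UxU; apply/subsetP => a aU.
    have := subsetP cover _ aU; rewrite inE => /orP[//|].
    rewrite !inE in yX *; exact: connect_trans yX.
  rewrite EU in gex; move: gex wU dense L1 U0; clear.
  by case: #|U| => // c; rewrite /= mulnS; lia.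
have dis a : a \in Ux -> a \in Uy -> False.
  rewrite !inE in yX *; move=> xa ya; case/negP: yX; apply: connect_trans xa _.
  by rewrite connect_induced_sym.
have cUxy : #|Ux| + #|Uy| <= #|U|.
  rewrite -cardsUI (_ : Ux :&: Uy = set0) ?cards0 ?addn0.
    by apply: subset_leq_card; rewrite subUset UxU.
  by apply/setP => a; rewrite in_set0 in_setI; apply/negP => /andP[/dis].
have wXY : weight M' U <= weight M' Ux + weight M' Uy.
  rewrite /weight; apply: leq_trans (leq_card_setU _ _); apply: subset_leq_card.
  apply/subsetP => e; rewrite inE => /andP[eM eU].
  have /card_gt0P[a ae] : 0 < #|e|.
    by case/orP: (proj1 mM' _ eM) => /eqP->; move: r3; clear; lia.
  have sub z : a \in component g' U z -> e \subset component g' U z.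
    move=> az; apply/subsetP => b be; have [->//|ab] := eqVneq b a.
    apply: component_closed az _ _ _; [exact: (subsetP eU) | exact: (subsetP eU)|].
    by apply: cM' eM ae be _; rewrite eq_sym.
  have := subsetP cover _ (subsetP eU _ ae).
  rewrite !in_setU => /orP[/sub se|/sub se]; apply/orP; [left|right];
    by rewrite in_set eM se.
have X0 : 0 < #|Ux| by apply/card_gt0P; exists x; rewrite inE connect0.
have Y0 : 0 < #|Uy| by apply/card_gt0P; exists y; rewrite inE connect0.
have LU : L * (#|Ux| + #|Uy|) <= L * #|U| by rewrite leq_mul2l cUxy orbT.
move: LU X0 Y0 gex gey wXY wU dense L1; clear; rewrite mulnDr.
move: #|Ux| #|Uy| => [//|c] [//|d] /=; rewrite !mulnS; lia.
Qed.

Hypothesis Hconn : forall U, U != set0 -> U != setT ->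
  exists h, [/\ h \in H, ~~ [disjoint h & U] & ~~ (h \subset U)].

(** At least [p1 + 1] edges inside [U], [p2 + 1] inside [W] and one link. The hyperedges are
    distinct: links other than the first miss [U] and so host no pair of the path there, and the
    first was avoided by that path; likewise at [W]. Pairs inside the disjoint sets have different
    hosts by [host_inj]. *)
Lemma cross_path U W (p1 p2 L1 L2 : nat) :
    connected_in g U -> (forall a b, a \in U -> g a b -> b \in U) ->
    connected_in g W -> (forall a b, a \in W -> g a b -> b \in W) -> [disjoint U & W] ->
    degree_weight r p1 L1 -> 1 < L1 -> L1 * #|U| <= weight M U ->
    degree_weight r p2 L2 -> 1 < L2 -> L2 * #|W| <= weight M W ->
  exists x s es, [/\ bpath H x s es, uniq (x :: s), uniq es & p1 + p2 + 3 <= size s].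
Proof.
move=> cU clU cW clW dUW h1 l1 d1 h2 l2 d2.
have [s0 [es [[us ues es0 sout] dU dW [hU hUs lW lWs] bp]]] :=
  ex_linking Hconn (proj1 cU) (proj1 cW) dUW.
have hes : head set0 es \in es by case: (es) es0 => // e es' _; rewrite mem_head.
have les : last set0 es \in es by case: (es) es0 => // e es' _; rewrite (mem_last e es').
have esH e : e \in es -> e \in H.
  move/pred0Pn: (hU) => [z /andP[zh _]]; move/pred0Pn: (lW) => [w /andP[wl _]].
  by move=> ee; apply: (bpath_mem (bp z w zh wl)).
have [z [su [zh gu pu hu]]] := path_avoiding_link_edge cU clU (esH _ hes) hU hUs h1 l1 d1.
have [w [sw [wl gw pw lw]]] := path_avoiding_link_edge cW clW (esH _ les) lW lWs h2 l2 d2.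
have bu := bpath_rev (bpath_edges_of hostP gu).
have bw := bpath_edges_of hostP gw.
have lastu : last (last z su) (rev (belast z su)) = z.
  by case: (su) => //= y s'; rewrite rev_cons last_rcons.
exists (last z su), (rev (belast z su) ++ (rcons s0 w ++ sw)),
  (rev (edges_of host z su) ++ (es ++ edges_of host w sw)); split.
- apply: bpath_cat bu _; rewrite lastu; apply: bpath_cat (bp z w zh wl) _.
  by rewrite last_rcons.
- rewrite -cat_cons rev_cons_belast cat_uniq rev_uniq.
  case/and3P: (gu) => _ _ ->; rewrite cat_rcons cat_uniq us.
  case/and3P: (gw) => _ _ ->; rewrite !andTb andbT; apply/andP; split.
    apply/hasPn => y; rewrite mem_cat mem_rev => yy; apply/negP => /(gpath_in gu) yU.
    case/orP: yy => [/sout/andP[/negP//]|/(gpath_in gw) yW].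
    by rewrite (disjointFr dUW yU) in yW.
  apply/hasPn => y /(gpath_in gw) yW; apply/negP => /sout.
  by rewrite yW andbF.
- rewrite cat_uniq rev_uniq (uniq_edges_of host_inj gu) cat_uniq ues (uniq_edges_of host_inj gw).
  rewrite /= andbT; apply/andP; split.
    apply/hasPn => e; rewrite mem_cat mem_rev => ee; apply/negP => eu.
    have [u [v [uu vu /andP[_ uv] E]]] := edges_ofP gu eu.
    have uU := gpath_in gu uu.
    case/orP: ee => ee.
      have [Eh|ne] := eqVneq e (head set0 es); first by rewrite -Eh eu in hu.
      have [_ /subsetP sub] := hostP uv.
      have := disjointFr (dU e ee ne) (x := u); rewrite uU E sub ?inE ?eqxx //.
      by move/(_ isT).
    have [u' [v' [uw' _ /andP[_ uv'] E']]] := edges_ofP gw ee.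
    have Ep := host_inj uv uv' (etrans (esym E) E').
    have : u' \in [set u; v] by rewrite Ep !inE eqxx.
    have := disjointFl dUW (gpath_in gw uw').
    rewrite !inE => n1 /orP[]/eqP Eu; rewrite Eu in n1; first by rewrite uU in n1.
    by rewrite (gpath_in gu vu) in n1.
  apply/hasPn => e ew; apply/negP => /= ee.
  have [Eh|ne] := eqVneq e (last set0 es); first by rewrite -Eh ew in lw.
  have [u [v [uw _ /andP[_ uv] E]]] := edges_ofP gw ew.
  have [_ /subsetP sub] := hostP uv.
  have := disjointFr (dW e ee ne) (x := u); rewrite (gpath_in gw uw) E sub ?inE ?eqxx //.
  by move/(_ isT).
rewrite !size_cat size_rev size_belast size_rcons.
by move: pu pw; clear; lia.
Qed.

End Cross.

(** * The bound for connected hypergraphs *)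

Section Global.
Variables (n r m : nat) (ev : bool).
Let T := 'I_n.
Variable H : {set {set T}}.
Hypothesis r3 : 2 < r.
Hypothesis rm : r + 6 <= m.
Let k := 2 * m + 1 + ev.
Let D := 'C(m, r.-1).
Hypothesis Hr : uniform r H.
Hypothesis Hc : hconnected H.
Hypothesis Hp : ~ has_berge_path H k.
Implicit Types (x y z u v w : T) (s : seq T) (e h p S U V W : {set T}).

Lemma hconnected_cut U : U != set0 -> U != setT ->
  exists h, [/\ h \in H, ~~ [disjoint h & U] & ~~ (h \subset U)].
Proof.
case/set0Pn => x xU UT.
have [/exists_inP[h hH /andP[h1 h2]]|/exists_inPn no] :=
  boolP [exists h in H, ~~ [disjoint h & U] && ~~ (h \subset U)].
  by exists h.
case/eqP: UT; apply/setP => y; rewrite inE.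
have /connectP[s ps ->] := Hc x y.
elim: s x xU ps => //= z s IH x xU /andP[/exists_inP[h hH /andP[xh zh]] ps].
apply: IH ps; apply: contraT => zU; have := no h hH; rewrite negb_and !negbK => /orP[dh|sh].
  by rewrite (disjointFr dh xh) in xU.
by rewrite (subsetP sh _ zh) in zU.
Qed.

(** The term [(k + 'C(k, r.-1)) * N + deficit] outweighs one dense component of at most [N] vertices
    when every other component loses one per vertex against [D]. The term [deficit * N] forces a
    component larger than [N] when there are at most [deficit] of them. *)
Definition order_bound :=
  let N := size_bound r m ev in
  (k + 'C(k, r.-1)) * N + deficit r m ev + deficit r m ev * N + N.

Lemma berge_bound : order_bound < n ->
  #|H| + deficit r m ev <= D * n /\
  (#|H| + deficit r m ev = D * n -> exists S x y,
     [/\ #|S| = m, x \notin S, y \notin S & x != y] /\ H = extremal r ev setT S x y).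
Proof.
rewrite /order_bound; set N := size_bound r m ev; set L := k + _; set c := deficit r m ev.
move=> hn.
have c0 : 0 < c by apply: deficit_gt0 r3 rm.
have Dm : m < D by have := bin_gap_link r3 rm (_ : 0 < m); rewrite bin_small;
  [rewrite add0n subn0; apply; move: rm; clear; lia | move: r3; clear; lia].
have [B [f [psi [BH f_inj fP psi_inj psiP]]]] := red_blue H.
pose g := pair_graph (matched H B f); pose M := mixed_family H B f.
have gsym : symmetric g by apply: pair_graph_sym.
have girr : irreflexive g by apply: pair_graph_irr.
have mM : mixed r M := mixed_mixed_family r3 Hr BH fP.
have cM e x y : e \in M -> x \in e -> y \in e -> x != y -> g x y.
  exact: (mixed_family_clique fP).
have hinj := host_inj f_inj fP psi_inj psiP.
have hP := hostP BH f_inj fP psiP.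
have np : nopath g setT k.
  move=> x s gs; rewrite ltnNge; apply/negP => ks; apply: Hp.
  apply: (bpath_has_berge_path (bpath_edges_of hP gs) _ (uniq_edges_of hinj gs) ks).
  by case/and3P: gs.
have cardM : #|M| = #|H| := card_mixed_family r3 Hr BH f_inj fP.
pose P := [set component g setT x | x in [set: T]].
have inP U : U \in P -> connected_in g U /\ forall a b, a \in U -> g a b -> b \in U.
  case/imsetP => x _ ->; split; first exact: component_conn.
  by move=> a b aU ab; apply: component_closed aU _ _ ab.
have eqP' U W a : U \in P -> W \in P -> a \in U -> a \in W -> U = W.
  move=> /imsetP[x _ ->] /imsetP[y _ ->]; rewrite !inE => xa ya.
  apply/setP => b; rewrite !inE.
  have sc : connect_sym (induced g setT) by apply: connect_induced_sym.
  by rewrite (same_connect sc xa) (same_connect sc ya).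
have dP U W : U \in P -> W \in P -> U != W -> [disjoint U & W].
  move=> UP WP UW; apply/pred0P => a /=; apply/negP => /andP[aU aW].
  by case/eqP: UW; apply: eqP' aU aW.
have compP x : component g setT x \in P by apply/imsetP; exists x.
have inC x : x \in component g setT x by rewrite inE connect0.
have partP : partition P [set: T].
  apply/and3P; split.
  - by apply/eqP/setP => x; rewrite inE; apply/bigcupP; exists (component g setT x).
  - by apply/trivIsetP => U W UP WP; apply: dP.
  by apply/negP => /inP[[]]; rewrite eqxx.
have sumn : n = \sum_(U in P) #|U| by rewrite -(card_partition partP) cardsT card_ord.
have sumw : #|H| <= \sum_(U in P) weight M U.
  have hb : #|\bigcup_(U in P) members M U| <= \sum_(U in P) weight M U.
    elim/big_ind2: _ => [|A a A' a' h1 h2|U _]; rewrite ?cards0 //.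
    by apply: leq_trans (leq_card_setU _ _) _; apply: leq_add.
  rewrite -cardM; apply: leq_trans hb; apply: subset_leq_card; apply/subsetP => e eM.
  have /card_gt0P[a ae] : 0 < #|e|.
    by case/orP: (proj1 mM _ eM) => /eqP->; move: r3; clear; lia.
  apply/bigcupP; exists (component g setT a) => //; rewrite inE eM /=.
  apply/subsetP => b be; have [->//|ab] := eqVneq b a.
  apply: component_closed (inC a) _ _ _; rewrite ?inE //.
  by apply: cM eM ae be _; rewrite eq_sym.
have npU U : nopath g U k by apply: nopath_sub np; apply: subsetT.
have large U : U \in P -> N < #|U| -> weight M U + c <= D * #|U|.
  move=> UP hU; have [cU _] := inP U UP.
  by have [] := connected_bound gsym girr r3 rm mM cM cU (npU U) hU.
have crude U : U \in P -> weight M U <= L * #|U|.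
  move=> UP; have [cU _] := inP U UP; have [U0 _] := cU; have /set0Pn[u uU] := U0.
  have hL : degree_weight r k L.
    move=> a b ab; apply: leq_add; first by move: ab; clear; lia.
    by apply: leq_bin2l; move: ab; clear; lia.
  apply: leq_trans (rooted_peel gsym r3 mM girr cM hL cU uU _) _.
    by move=> s gs; apply: ltnW; apply: npU gs.
  by rewrite leq_mul2l leq_pred orbT.
have strict : #|H| + c < D * n -> #|H| + c <= D * n /\
  (#|H| + c = D * n -> exists S x y,
     [/\ #|S| = m, x \notin S, y \notin S & x != y] /\ H = extremal r ev setT S x y).
  by move=> lt; split; [apply: ltnW | move=> E; rewrite E ltnn in lt].
have Dn : D * n = \sum_(U in P) D * #|U| by rewrite [in LHS]sumn big_distrr.
have [/exists_inP[U UP dense]|/exists_inPn sparse] := boolP [exists U in P, D * #|U| <= weight M U].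
  apply: strict.
  have sU : #|U| <= N.
    by rewrite leqNgt; apply/negP => /(large U UP); move: dense c0; clear; lia.
  (* A second component with [D - 1] members per vertex would give a Berge path of length
     [m + (m - 1) + 3 = 2 * m + 2 >= k]. *)
  have others W : W \in P -> W != U -> weight M W <= D.-1 * #|W|.
    move=> WP WU; rewrite leqNgt; apply/negP => /ltnW dW.
    have [cU clU] := inP U UP; have [cW clW] := inP W WP.
    have dUW : [disjoint U & W] by apply: dP; rewrite // eq_sym.
    have D1 : 1 < D by move: Dm rm; clear; lia.
    have D2 : 1 < D.-1 by move: Dm rm; clear; lia.
    have [x [s [es [hb us ues hs]]]] := cross_path r3 Hr BH f_inj fP psi_inj psiP
      hconnected_cut cU clU cW clW dUW (degree_weight_m r3 rm) D1 dense
      (degree_weight_pred r3 rm) D2 dW.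
    apply: Hp; apply: (bpath_has_berge_path hb us ues); apply: leq_trans hs.
    by rewrite /k; move: rm; case: (ev) => /=; clear; lia.
  have h1 : \sum_(W in P) weight M W <= L * N + D.-1 * n.
    rewrite (bigD1 U) //=; apply: leq_add.
      by apply: leq_trans (crude U UP) _; rewrite leq_mul2l sU orbT.
    rewrite [in leqRHS]sumn big_distrr /= [in leqRHS](bigD1 U) //=.
    apply: leq_trans (leq_addl _ _); apply: leq_sum => W /andP[WP WU]; exact: others.
  have h2 : D * n = D.-1 * n + n by move: Dm; case: (D) => // d _; rewrite /= mulSn addnC.
  move: (leq_trans sumw h1) h2 hn; clear.
  by move: c N #|H| (c * N) (L * N) (D.-1 * n) (D * n) => q1 q2 q3 q4 q5 q6 q7; lia.
have sp U : U \in P -> (weight M U).+1 <= D * #|U| by move=> /sparse; rewrite -ltnNge.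
(* Every component now lies at least one below [D] per vertex, so more than [deficit] components
   already push the total strictly below the bound. *)
have [Pc|cP] := leqP #|P| c; last first.
  apply: strict; rewrite Dn; apply: leq_trans (_ : \sum_(U in P) (weight M U).+1 <= _); last exact: leq_sum.
  rewrite (eq_bigr (fun U => weight M U + 1)); last by move=> U _; rewrite addn1.
  by rewrite big_split /= sum1_card -addnS; apply: leq_add sumw cP.
have /exists_inP[W WP hW] : [exists W in P, N < #|W|].
  apply: contraT => /exists_inPn h; suff : n <= c * N by move: hn; clear; lia.
  rewrite {1}sumn; apply: leq_trans (_ : \sum_(U in P) N <= _).
    by apply: leq_sum => U UP; rewrite leqNgt h.
  by rewrite sum_nat_const leq_mul2r Pc orbT.
have lW := large W WP hW.
(* The large component accounts for the whole [deficit]; any other component loses one more. *)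
have [EW|nW] := eqVneq W setT; last first.
  apply: strict.
  have /subsetPn[x _ xW] : ~~ (setT \subset W) by rewrite subTset.
  have UW : component g setT x != W by apply: contraNneq xW => <-.
  rewrite Dn (bigD1 W) //= (bigD1 (component g setT x)) ?compP //=.
  move: sumw; rewrite (bigD1 W) //= (bigD1 (component g setT x)) ?compP //=.
  have : \sum_(U | (U \in P) && (U != W) && (U != component g setT x)) weight M U <=
      \sum_(U | (U \in P) && (U != W) && (U != component g setT x)) D * #|U|.
    by apply: leq_sum => U /andP[/andP[UP _] _]; apply: ltnW; apply: sp.
  move=> h1 h2; apply: leq_trans (leq_add lW (leq_add (sp _ (compP x)) h1)).
  by rewrite addSn addnS ltnS addnAC leq_add2r.
have [cT _] := inP W WP.
rewrite EW in cT hW.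
have [h1 h2] := connected_bound gsym girr r3 rm mM cM cT np hW.
have EM : members M setT = M by apply/setP => e; rewrite inE subsetT andbT.
have wT : weight M setT = #|H| by rewrite -cardM -[in RHS]EM.
rewrite wT cardsT card_ord in h1 h2; split=> // E.
have [S [x [y [[Sm _ /setDP[_ xS] /setDP[_ yS] xy] EX]]]] := h2 E.
exists S, x, y; split=> //; rewrite -EX EM.
(* All members of an extremal family have [r > 2] elements, so there is no red pair and [H] is its
   own blue family. *)
have HB : H \subset B.
  apply/subsetP => e eH; apply: contraT => eB.
  have eHB : e \in H :\: B by rewrite inE eB.
  have : f e \in M by rewrite inE; apply/orP; left; apply/imsetP; exists e.
  rewrite -EM EX in_extremal => /andP[/eqP fr _]; have [f2 _ _] := fP e eHB.
  by move: r3; rewrite -fr f2.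
have EB : H = B by apply/eqP; rewrite eqEsubset HB.
by rewrite /M /mixed_family /red EB setDv imset0 set0U.
Qed.

End Global.

(** * The extremal hypergraph *)

Section ExtremalHypergraph.
Variables (n r m : nat) (ev : bool).
Let T := 'I_n.
Implicit Types (x y z : T) (S A e : {set T}).

Lemma card_extremalT S x y : 2 < r -> x \notin S -> y \notin S -> x != y ->
  #|extremal r ev setT S x y| = 'C(#|S|, r - 1) * (n - #|S|) + 'C(#|S|, r) + ev * 'C(#|S|, r - 2).
Proof.
by move=> r3 xS yS xy; rewrite card_extremal ?subsetT ?cardsT ?card_ord // !inE ?xS ?yS.
Qed.

(** List the vertices on each side as the core, the two special vertices, the rest, and match
    positions. Equal cardinalities reduce equality of the families to one inclusion. *)
Lemma extremal_isomorphic S x y A a b : 2 < r -> #|S| = #|A| ->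
    x \notin S -> y \notin S -> x != y -> a \notin A -> b \notin A -> a != b ->
  isomorphic (extremal r ev setT S x y) (extremal r ev setT A a b).
Proof.
move=> r3 SA xS yS xy aA bA ab.
pose enumeration S x y := enum S ++ x :: y :: enum (~: (x |: (y |: S))).
have enum_uniq' S' x' y' : x' \notin S' -> y' \notin S' -> x' != y' ->
    uniq (enumeration S' x' y').
  move=> xS' yS' xy'; rewrite cat_uniq enum_uniq /= !enum_uniq andbT.
  rewrite !mem_enum (negbTE xS') (negbTE yS') !inE !mem_enum !inE !eqxx (negbTE xy') /=.
  rewrite orbT !andbT; apply/hasPn => z; rewrite !mem_enum !inE !negb_or.
  by case/and3P.
have enum_all S' x' y' z : z \in enumeration S' x' y'.
  rewrite mem_cat !inE !mem_enum !inE.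
  by case: (z \in S'); case: (z == x'); case: (z == y').
have size_enum S' x' y' : x' \notin S' -> y' \notin S' -> x' != y' ->
    size (enumeration S' x' y') = n.
  move=> xS' yS' xy'; rewrite -[RHS](card_ord n); apply/esym.
  rewrite -(card_uniqP (enum_uniq' S' x' y' xS' yS' xy')).
  by apply: eq_card => z; rewrite enum_all.
pose l1 := enumeration S x y; pose l2 := enumeration A a b.
pose F z := nth a l2 (index z l1).
have idx z : index z l1 < size l2.
  have -> : size l2 = size l1 := etrans (size_enum _ _ _ aA bA ab) (esym (size_enum _ _ _ xS yS xy)).
  by rewrite index_mem enum_all.
have Finj : injective F.
  move=> z z' /eqP; rewrite nth_uniq ?idx ?(enum_uniq' _ _ _ aA bA ab) // => /eqP E.
  by rewrite -(nth_index x (enum_all S x y z)) -(nth_index x (enum_all S x y z')) E.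
have FS : F @: S = A.
  apply/eqP; rewrite eqEcard card_imset // SA leqnn andbT; apply/subsetP => _ /imsetP[z zS ->].
  have zi : index z l1 < size (enum A).
    by rewrite index_cat mem_enum zS -cardE -SA cardE index_mem mem_enum.
  by rewrite /F nth_cat zi -mem_enum mem_nth.
have Fx : F x = a.
  rewrite /F index_cat mem_enum (negbTE xS) /= eqxx addn0 nth_cat -!cardE SA ltnn subnn //.
have Fy : F y = b.
  by rewrite /F index_cat mem_enum (negbTE yS) /= (negbTE xy) eqxx nth_cat -!cardE SA addn1
     ltnNge leqnSn /= subSnn.
exists (perm Finj); apply/eqP; rewrite eqEcard card_imset; last first.
  by apply: imset_inj; apply: perm_inj.
rewrite !card_extremalT // SA leqnn andbT.
have Fi e : perm Finj @: e = F @: e by apply: eq_imset => z; rewrite permE.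
apply/subsetP => _ /imsetP[e eE ->]; rewrite Fi.
move: eE; rewrite !in_extremal card_imset // => /andP[-> /=].
have -> : F @: e :\: A = F @: (e :\: S).
  rewrite -FS; apply/setP => z; apply/setDP/imsetP => [[/imsetP[u ue ->] uS]|[u /setDP[ue uS] ->]].
    by exists u => //; rewrite inE ue andbT; apply: contraNN uS; apply: imset_f.
  by split; [apply: imset_f | rewrite mem_imset].
rewrite !in_setU1 => /orP[/eqP->|]; first by rewrite imset0 eqxx.
rewrite in_setU => /orP[/imsetP[v /setDP[_ vS] ->]|h]; apply/orP; right; rewrite in_setU; apply/orP.
  left; rewrite imset_set1; apply/imsetP; exists (F v) => //; rewrite !inE andbT -FS.
  by apply: contraNN vS => /imsetP[z zS /Finj ->].
right; move: h; case: (ev); rewrite !inE // => /eqP->.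
by rewrite imsetU !imset_set1 Fx Fy.
Qed.

Lemma extremal_uniform S x y : uniform r (extremal r ev setT S x y).
Proof. by move=> e; rewrite in_extremal => /andP[/eqP]. Qed.

(** Every vertex shares a hyperedge with one fixed [a] in [S]; for a vertex of [S], [r <= #|S|]
    provides such a hyperedge inside [S]. *)
Lemma extremal_connected S x y : 1 < r -> r <= #|S| -> hconnected (extremal r ev setT S x y).
Proof.
move=> r1 rS.
have /card_gt0P[a aS] : 0 < #|S| by move: r1 rS; clear; lia.
have adj z : hadj (extremal r ev setT S x y) z a.
  have [zS|zS] := boolP (z \in S).
    have [||e [ze eS ce]] := @subset_card_between _ [set z; a] S r.
    - by rewrite subUset !sub1set zS.
    - by rewrite cards2 rS andbT; apply: leq_trans r1; case: (_ != _).
    apply/exists_inP; exists e; last by rewrite !(subsetP ze) // !inE eqxx ?orbT.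
    rewrite in_extremal ce eqxx /=.
    by have -> : e :\: S = set0; [apply/eqP; rewrite setD_eq0 | rewrite in_setU1 eqxx].
  have [||e [ze eS ce]] := @subset_card_between _ [set a] S r.-1.
  - by rewrite sub1set.
  - by rewrite cards1 -ltnS (ltn_predK r1) r1 (leq_trans (leq_pred r) rS).
  have zne : z \notin e by apply: contraNN zS; apply: (subsetP eS).
  apply/exists_inP; exists (z |: e); last first.
    by rewrite setU11 in_setU (subsetP ze) ?orbT // inE.
  rewrite in_extremal cardsU1 zne ce; apply/andP; split.
    by apply/eqP; move: r1; clear; lia.
  have -> : (z |: e) :\: S = [set z].
    apply/setP => u; rewrite !inE; have [->|_] /= := eqVneq u z; first by rewrite zS.
    by case ue : (u \in e); rewrite ?andbF // (subsetP eS).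
  rewrite in_setU1 in_setU; apply/orP; right; apply/orP; left.
  by apply/imsetP; exists z; rewrite // !inE zS.
have hsym : symmetric (hadj (extremal r ev setT S x y)).
  move=> u v; apply/exists_inP/exists_inP => -[e eE uv]; exists e => //; by rewrite andbC.
move=> u v; apply: (@connect_trans _ _ a); first exact: connect1.
by apply: connect1; rewrite hsym.
Qed.

(* Cut a path into [m + 1] disjoint consecutive pairs; the only pair avoiding [S] is
   [{x, y}], and starting one vertex later separates [x] from [y]. *)
Lemma extremal_no_path S x y : #|S| = m ->
  ~ has_berge_path (extremal r ev setT S x y) (2 * m + 1 + ev).
Proof.
set k := 2 * m + 1 + ev; move=> Sm [v [e [vinj [_ he]]]].
pose vv i := v (inord i).
have vvinj i j : i <= k -> j <= k -> vv i = vv j -> i = j.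
  by move=> ik jk /vinj /(congr1 val); rewrite /= !inordK.
have step i : i < k -> vv i \notin S -> vv i.+1 \notin S -> ev /\ [set vv i; vv i.+1] = [set x; y].
  move=> ik n1 n2; have [eE v1 v2] := he (Ordinal ik).
  have E1 : widen_ord (leqnSn k) (Ordinal ik) = inord i.
    by apply: val_inj; rewrite /= inordK //; apply: ltnW.
  have E2 : lift ord0 (Ordinal ik) = inord i.+1 by apply: val_inj; rewrite /= inordK.
  rewrite E1 -/(vv i) in v1; rewrite E2 -/(vv i.+1) in v2.
  move: eE; rewrite in_extremal => /andP[_].
  set Y := e _ :\: S.
  have sub : [set vv i; vv i.+1] \subset Y by rewrite subUset !sub1set !inE n1 n2 v1 v2.
  have ne : vv i != vv i.+1.
    by apply/eqP => /(vvinj i i.+1 (ltnW ik) ik); clear; lia.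
  rewrite in_setU1 => /orP[/eqP E|].
    by move/subset_leq_card: sub; rewrite E cards0 cards2 ne.
  rewrite in_setU => /orP[/imsetP[z _ E]|].
    by move/subset_leq_card: sub; rewrite E cards1 cards2 ne.
  case: (ev); rewrite inE // => /eqP E; split=> //.
  apply/eqP; rewrite eqEcard -E sub E !cards2 ne; by case: (x != y).
have shift o : 2 * m + o < k ->
    (forall j, j <= m -> (vv (2 * j + o) \in S) || (vv (2 * j + o).+1 \in S)) -> False.
  move=> ok hS.
  pose c (j : 'I_m.+1) := if vv (2 * j + o) \in S then 2 * j + o else (2 * j + o).+1.
  have cS j : vv (c j) \in S.
    by rewrite /c; case: ifP => // h; have := hS j; rewrite h /=; apply; rewrite -ltnS.
  have cinj : injective (fun j => vv (c j)).
    have ck (j : 'I_m.+1) : c j <= k.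
      by rewrite /c; move: (ltn_ord j) ok; clear; case: ifP => _; lia.
    move=> i j /(vvinj _ _ (ck i) (ck j)); rewrite /c => E; apply: val_inj => /=.
    by move: E; clear; do 2!case: ifP => _; lia.
  have : #|[set vv (c j) | j : 'I_m.+1]| <= #|S|.
    by apply: subset_leq_card; apply/subsetP => _ /imsetP[j _ ->].
  by rewrite card_imset // card_ord Sm ltnn.
have [/'forall_orP h|/forallPn[j hj]] :=
  boolP [forall j : 'I_m.+1, (vv (2 * j + 0) \in S) || (vv (2 * j + 0).+1 \in S)].
  apply: (shift 0); first by rewrite /k; clear; lia.
  move=> j jm; have jm' : j < m.+1 by [].
  by apply/orP; have := h (Ordinal jm').
move: hj; rewrite negb_or => /andP[n1 n2].
have jk : 2 * j + 0 < k by move: (ltn_ord j); rewrite /k; clear; lia.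
have [evT E1] := step _ jk n1 n2.
apply: (shift 1); first by rewrite /k evT; clear; lia.
move=> i im; apply: contraT; rewrite negb_or => /andP[n3 n4].
have ik : 2 * i + 1 < k by move: im; rewrite /k evT; clear; lia.
have [_ E2] := step _ ik n3 n4.
have /setP E : [set vv (2 * j + 0); vv (2 * j + 0).+1] = [set vv (2 * i + 1); vv (2 * i + 1).+1].
  by rewrite E1 E2.
have b1 : 2 * j + 0 <= k by apply: ltnW.
have b2 : 2 * i + 1 <= k by apply: ltnW.
have := E (vv (2 * j + 0)); rewrite !inE eqxx => /esym/orP[]/eqP/vvinj h1.
  by have := h1 b1 b2; clear; lia.
have := E (vv (2 * j + 0).+1); rewrite !inE eqxx orbT => /esym/orP[]/eqP/vvinj h2.
  by have := h1 b1 ik; have := h2 jk b2; clear; lia.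
by have := h2 jk ik; clear; lia.
Qed.

End ExtremalHypergraph.

(** * Identification of [Hnk] and the final assembly *)

Lemma Hnk_extremal n k r m (h1 : m < n) (h2 : m.+1 < n) : 2 < k -> m = (k - 1) %/ 2 ->
  Hnk n k r = extremal r (~~ odd k) setT [set v : 'I_n | val v < m] (Ordinal h1) (Ordinal h2).
Proof.
move=> k2 mE.
have AE : Hsize_A k = m.
  rewrite /Hsize_A mE; case: ifP => // ok; move: ok k2; clear; lia.
apply/setP => e; rewrite [LHS]inE in_extremal /Hset_A AE; congr (_ && _).
set A := [set v : 'I_n | val v < m].
have -> : [set v : 'I_n | (val v == m) || (val v == m.+1)] = [set Ordinal h1; Ordinal h2].
  by apply/setP => v; rewrite !inE -!val_eqE.
rewrite in_setU1 in_setU orbA; congr (_ || _); last first.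
  by case: (odd k); rewrite /= inE.
apply/idP/orP => [|[/eqP->|/imsetP[v _ ->]]]; rewrite ?cards0 ?cards1 //.
rewrite leq_eqVlt ltnS leqn0 cards_eq0 => /orP[/cards1P[v E]|]; [right|by left].
by apply/imsetP; exists v => //; have := set11 v; rewrite -{1}E !inE => /andP[-> _].
Qed.

Theorem mainTheorem1 (r k : nat) (hr : 3 <= r) (hk : 2 * r + 13 <= k) :
  exists N : nat, forall n : nat, N < n ->
    [/\ (forall H : {set {set 'I_n}}, uniform r H -> hconnected H ->
           ~ has_berge_path H k -> #|H| <= extremal_bound n k r),
        [/\ uniform r (Hnk n k r), hconnected (Hnk n k r),
            ~ has_berge_path (Hnk n k r) k &
            #|Hnk n k r| = extremal_bound n k r] &
        (forall H : {set {set 'I_n}}, uniform r H -> hconnected H ->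
           ~ has_berge_path H k -> #|H| = extremal_bound n k r ->
           isomorphic H (Hnk n k r))].
Proof.
pose m := (k - 1) %/ 2; pose ev := ~~ odd k.
have kE : k = 2 * m + 1 + ev by rewrite /m /ev; move: hk hr; clear; lia.
(* Half of [2 * r + 12]; with [d = r - 2] it is the margin [d + 8 <= m] of the binomial
   estimates. *)
have rm : r + 6 <= m by rewrite /m; move: hk hr; clear; lia.
(* The summand [m.+1] guarantees that the vertices numbered [m] and [m.+1], the special pair of
   [Hnk], exist. *)
exists (order_bound r m ev + m.+1) => n hn.
have h1 : m < n by move: hn; clear; lia.
have h2 : m.+1 < n by move: hn; clear; lia.
have hN : order_bound r m ev < n by move: hn; clear; lia.
have k2 : 2 < k by move: hk; clear; lia.
have EH := Hnk_extremal r h1 h2 k2 (erefl m).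
set A := [set v : 'I_n | val v < m] in EH.
have cA : #|A| = m.
  have := card_in_imset (f := widen_ord (ltnW h1)) (D := [set: 'I_m]).
  rewrite cardsT card_ord => <-; last by move=> i j _ _ /(congr1 val) /= /val_inj.
  apply: eq_card => v; rewrite inE; apply/idP/imsetP => [vm|[i _ ->]] /=; last exact: ltn_ord.
  by exists (Ordinal vm); [rewrite inE | apply: val_inj].
have nA1 : Ordinal h1 \notin A by rewrite inE /= ltnn.
have nA2 : Ordinal h2 \notin A by rewrite inE /= -leqNgt.
have nA12 : Ordinal h1 != Ordinal h2 by rewrite -val_eqE /= neq_ltn leqnn.
have bE : extremal_bound n k r + deficit r m ev = 'C(m, r.-1) * n.
  exact: (extremal_deficit ev hr rm (ltnW h1)).
split.
- move=> H uH cH; rewrite {1}kE => nH.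
  have [le _] := berge_bound hr rm uH cH nH hN.
  by rewrite -bE leq_add2r in le.
- rewrite EH; split.
  + exact: extremal_uniform.
  + by apply: extremal_connected; rewrite ?cA; move: hr rm; clear; lia.
  + by rewrite [k in has_berge_path _ k]kE; apply: extremal_no_path.
  by rewrite card_extremalT // cA.
move=> H uH cH nH cardH; rewrite kE in nH.
have [_ eq] := berge_bound hr rm uH cH nH hN.
have [|S [x [y [[Sm xS yS xy] ->]]]] := eq; first by rewrite cardH bE.
by rewrite EH; apply: extremal_isomorphic; rewrite // Sm.
Qed.
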